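(* Let $m,\omega,\hbar>0$ be real numbers and let $\xi=\mathbf{e_1}\xi_{\widehat 1}+\mathbf{e_2}\xi_{\widehat 2}$ with $\xi_{\widehat 1},\xi_{\widehat 2}$ positive real numbers. Let $M$ be the $\mathbb{T}$-module of all functions $u(x)=\mathbf{e_1}u_{\widehat 1}(x)+\mathbf{e_2}u_{\widehat 2}(x)$ of a real variable $x$ with $u_{\widehat 1},u_{\widehat 2}\in L^2(\mathbb{R})$ (with values in $\mathbb{C}(\mathbf{i_1})$). For each integer $l\ge 0$ let $$\phi_l(x)=\mathbf{e_1}\phi_{l\widehat 1}(x)+\mathbf{e_2}\phi_{l\widehat 2}(x),\qquad \phi_{l\widehat k}(x)=\left[\sqrt{\frac{m\omega}{\pi\hbar\xi_{\widehat k}}}\,\frac{1}{2^l l!}\right]^{1/2}e^{-\theta_{\widehat k}^2/2}H_l(\theta_{\widehat k}),\qquad \theta_{\widehat k}=\sqrt{\frac{m\omega}{\hbar\xi_{\widehat k}}}\,x\quad(k=1,2),$$ where $H_l$ are the Hermite polynomials. Then any $u\in M$ can be expanded uniquely as $u=\sum_{l=0}^\infty w_l\phi_l$, where each $w_l$ is a bicomplex number.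
   Context: Bicomplex numbers: $\mathbb{T}=\{z_1+z_2\mathbf{i_2} : z_1,z_2\in\mathbb{C}(\mathbf{i_1})\}$ with $\mathbb{C}(\mathbf{i_1})=\{x+y\mathbf{i_1}: x,y\in\mathbb{R}\}$, $\mathbf{i_1}^2=\mathbf{i_2}^2=-1$, $\mathbf{j}=\mathbf{i_1}\mathbf{i_2}=\mathbf{i_2}\mathbf{i_1}$, $\mathbf{j}^2=1$; this is a commutative ring. Put $\mathbf{e_1}=(1+\mathbf{j})/2$, $\mathbf{e_2}=(1-\mathbf{j})/2$, so $\mathbf{e_1}+\mathbf{e_2}=1$, $\mathbf{e_1}\mathbf{e_2}=0$, $\mathbf{e_k}^2=\mathbf{e_k}$. Each $w\in\mathbb{T}$ is uniquely $w=z_{\widehat 1}\mathbf{e_1}+z_{\widehat 2}\mathbf{e_2}$ with $z_{\widehat k}\in\mathbb{C}(\mathbf{i_1})$. $M$ carries the bicomplex scalar product $(u,v)=\int_{-\infty}^{\infty}\left[\mathbf{e_1}\bar u_{\widehat 1}(x)v_{\widehat 1}(x)+\mathbf{e_2}\bar u_{\widehat 2}(x)v_{\widehat 2}(x)\right]dx$ (bar = complex conjugation in $\mathbb{C}(\mathbf{i_1})$) and the induced norm $\|u\|=\frac{1}{\sqrt 2}\sqrt{\|u_{\widehat 1}\|_{L^2}^2+\|u_{\widehat 2}\|_{L^2}^2}$; the series converges with respect to this norm. Elements of $L^2(\mathbb{R})$ are identified when equal almost everywhere. $H_l$ are the (physicists') Hermite polynomials, $H_l(t)=(-1)^l e^{t^2}\frac{d^l}{dt^l}e^{-t^2}$.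 *)

(* Defs.v *)
From HB Require Import structures.
From mathcomp Require Import all_boot all_order all_algebra.
From mathcomp Require Import all_classical all_reals all_analysis.
From mathcomp Require Import complex.
From mathcomp Require Import measurable_realfun ring.

Set Implicit Arguments.
Unset Strict Implicit.
Unset Printing Implicit Defensive.
Import Order.TTheory GRing.Theory Num.Theory.
Import numFieldNormedType.Exports.

Local Open Scope classical_set_scope.
Local Open Scope ring_scope.

(* [Bicomplex z1 z2] is z1 + z2 i2, with i1 the imaginary unit of R[i]. *)
Record bicomplex (R : realType) := Bicomplex { bc_fst : R[i]; bc_snd : R[i] }.

Section BicomplexRing.
Variable R : realType.
Local Notation C := R[i].
Local Notation T := (bicomplex R).
Implicit Types w : T.

Definition bc_pair w : C * C := (bc_fst w, bc_snd w).
Definition pair_bc (p : C * C) : T := Bicomplex p.1 p.2.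

Lemma bc_pairK : cancel bc_pair pair_bc.
Proof. by case. Qed.

HB.instance Definition _ := Choice.copy T (can_type bc_pairK).

Definition bc_zero : T := Bicomplex 0 0.
Definition bc_one : T := Bicomplex 1 0.
Definition bc_opp w : T := Bicomplex (- bc_fst w) (- bc_snd w).
Definition bc_add w w' : T :=
  Bicomplex (bc_fst w + bc_fst w') (bc_snd w + bc_snd w').
Definition bc_mul w w' : T :=
  Bicomplex (bc_fst w * bc_fst w' - bc_snd w * bc_snd w')
            (bc_fst w * bc_snd w' + bc_snd w * bc_fst w').

Lemma bc_addA : associative bc_add.
Proof. by move=> u v w; rewrite /bc_add /= !addrA. Qed.
Lemma bc_addC : commutative bc_add.
Proof. by move=> u v; rewrite /bc_add addrC [X in Bicomplex _ X]addrC. Qed.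
Lemma bc_add0 : left_id bc_zero bc_add.
Proof. by case=> a b; rewrite /bc_add /= !add0r. Qed.
Lemma bc_addN : left_inverse bc_zero bc_opp bc_add.
Proof. by move=> w; rewrite /bc_add /= !addNr. Qed.

HB.instance Definition _ :=
  GRing.isZmodule.Build T bc_addA bc_addC bc_add0 bc_addN.

Lemma bc_mulA : associative bc_mul.
Proof. by move=> u v w; rewrite /bc_mul /=; congr Bicomplex; ring. Qed.
Lemma bc_mulC : commutative bc_mul.
Proof. by move=> u v; rewrite /bc_mul /=; congr Bicomplex; ring. Qed.
Lemma bc_mul1 : left_id bc_one bc_mul.
Proof. by case=> a b; rewrite /bc_mul !mul1r !mul0r subr0 addr0. Qed.
Lemma bc_mulD : left_distributive bc_mul bc_add.
Proof. by move=> u v w; rewrite /bc_mul /bc_add /=; congr Bicomplex; ring. Qed.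
Lemma bc_one_neq0 : bc_one != bc_zero.
Proof. by apply/eqP => -[/eqP]; rewrite oner_eq0. Qed.

HB.instance Definition _ :=
  GRing.Zmodule_isComNzRing.Build T bc_mulA bc_mulC bc_mul1 bc_mulD bc_one_neq0.

End BicomplexRing.

Section Idempotent.
Variable R : realType.
Local Notation T := (bicomplex R).

Definition bcC (z : R[i]) : T := Bicomplex z 0.
Definition bc_i1 : T := bcC (Complex 0 1).
Definition bc_i2 : T := Bicomplex 0 1.
Definition bc_j : T := bc_i1 * bc_i2.
Definition bc_e1 : T := bcC 2^-1 * (1 + bc_j).
Definition bc_e2 : T := bcC 2^-1 * (1 - bc_j).

(* Since i2 e1 = - i1 e1 and i2 e2 = i1 e2, the coefficients of
   z1 + z2 i2 on e1 and e2 are z1 - i1 z2 and z1 + i1 z2. *)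
Definition bc_hat1 (w : T) : R[i] := bc_fst w - Complex 0 1 * bc_snd w.
Definition bc_hat2 (w : T) : R[i] := bc_fst w + Complex 0 1 * bc_snd w.

Let ii : Complex 0 1 * Complex 0 1 = -1 :> R[i].
Proof. by rewrite -expr2 sqr_i. Qed.

Lemma bcE (w w' : T) : w + w' = bc_add w w'. Proof. by []. Qed.
Lemma bcM (w w' : T) : w * w' = bc_mul w w'. Proof. by []. Qed.
Lemma bcN (w : T) : - w = bc_opp w. Proof. by []. Qed.
Lemma bc1 : 1 = bc_one R. Proof. by []. Qed.

Lemma bc_e1E : bc_e1 = Bicomplex 2^-1 (2^-1 * Complex 0 1).
Proof.
by rewrite /bc_e1 /bc_j bc1 !(bcE, bcM) /bc_mul /bc_add /=; congr Bicomplex; ring.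
Qed.
Lemma bc_e2E : bc_e2 = Bicomplex 2^-1 (- (2^-1 * Complex 0 1)).
Proof.
by rewrite /bc_e2 /bc_j bc1 !(bcE, bcM, bcN) /bc_mul /bc_add /bc_opp /=;
  congr Bicomplex; ring.
Qed.

Lemma bc_hatE (w : T) : w = bc_e1 * bcC (bc_hat1 w) + bc_e2 * bcC (bc_hat2 w).
Proof.
case: w => a b; rewrite bc_e1E bc_e2E !(bcE, bcM) /bc_mul /bc_add /bc_hat1 /bc_hat2 /=.
have h2 : (2 : R[i]) != 0 by rewrite pnatr_eq0.
move: (Complex 0 1) ii => i hi.
congr Bicomplex; first by field.
by transitivity (- (i * i) * b); [rewrite hi opprK mul1r | field].
Qed.

Lemma bc_hat1_idem a b : bc_hat1 (bc_e1 * bcC a + bc_e2 * bcC b) = a.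
Proof.
rewrite bc_e1E bc_e2E !(bcE, bcM) /bc_mul /bc_add /bc_hat1 /=.
have h2 : (2 : R[i]) != 0 by rewrite pnatr_eq0.
move: (Complex 0 1) ii => i hi.
transitivity (2^-1 * (a + b) - (i * i) * (2^-1 * (a - b))); first by field.
by rewrite hi; field.
Qed.

Lemma bc_hat2_idem a b : bc_hat2 (bc_e1 * bcC a + bc_e2 * bcC b) = b.
Proof.
rewrite bc_e1E bc_e2E !(bcE, bcM) /bc_mul /bc_add /bc_hat2 /=.
have h2 : (2 : R[i]) != 0 by rewrite pnatr_eq0.
move: (Complex 0 1) ii => i hi.
transitivity (2^-1 * (a + b) + (i * i) * (2^-1 * (a - b))); first by field.
by rewrite hi; field.
Qed.

Lemma bc_hat1_lin (w u v : T) :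
  bc_hat1 (w * u + v) = bc_hat1 w * bc_hat1 u + bc_hat1 v.
Proof.
rewrite bcE bcM /bc_hat1 /bc_add /bc_mul /=.
move: (Complex 0 1) ii => i hi.
by rewrite -[bc_snd w * bc_snd u]opprK -[- (bc_snd w * _)]mulN1r -hi; ring.
Qed.

Lemma bc_hat2_lin (w u v : T) :
  bc_hat2 (w * u + v) = bc_hat2 w * bc_hat2 u + bc_hat2 v.
Proof.
rewrite bcE bcM /bc_hat2 /bc_add /bc_mul /=.
move: (Complex 0 1) ii => i hi.
by rewrite -[bc_snd w * bc_snd u]opprK -[- (bc_snd w * _)]mulN1r -hi; ring.
Qed.

End Idempotent.

Section L2.
Variable R : realType.

Definition L2norm (f : R -> R[i]) : \bar R :=
  'N[lebesgue_measure]_2%:E[EFin \o (@ComplexField.Normc.normc R \o f)]%E.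

(* Functions stand for their classes modulo equality almost everywhere: the
   norm, hence convergence in norm, is the same for almost everywhere equal
   functions (bcL2_norm_ae_eq). *)
Definition L2 : set (R -> R[i]) :=
  [set f | [/\ measurable_fun setT (fun x => complex.Re (f x)),
               measurable_fun setT (fun x => complex.Im (f x)) &
               (L2norm f < +oo)%E]].

Definition bcL2 : set (R -> bicomplex R) :=
  [set u | L2 (fun x => bc_hat1 (u x)) /\ L2 (fun x => bc_hat2 (u x))].

Definition bcL2_norm (u : R -> bicomplex R) : \bar R :=
  ((Num.sqrt 2)^-1%:E *
   sqrte (L2norm (fun x => bc_hat1 (u x)) ^+ 2 +
          L2norm (fun x => bc_hat2 (u x)) ^+ 2))%E.

Local Notation mu := (@lebesgue_measure R).
Local Notation nc := (@ComplexField.Normc.normc R).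
Local Notation mRe f := (measurable_fun setT (fun x : R => complex.Re (f x))).
Local Notation mIm f := (measurable_fun setT (fun x : R => complex.Im (f x))).

Lemma measurable_normc (f : R -> R[i]) :
  mRe f -> mIm f -> measurable_fun setT (nc \o f).
Proof.
move=> mr mi.
rewrite (_ : nc \o f = (fun y => Num.sqrt y) \o
  (fun x => complex.Re (f x) ^+ 2 + complex.Im (f x) ^+ 2)); last first.
  by apply/funext => x /=; case: (f x).
apply: measurableT_comp; first by apply: continuous_measurable_fun; exact: sqrt_continuous.
by apply: measurable_funD; exact: measurable_funX.
Qed.

Lemma L2norm_ae_eq (f g : R -> R[i]) : mRe f -> mIm f -> mRe g -> mIm g ->
  {ae mu, forall x, f x = g x} -> L2norm f = L2norm g.
Proof.
move=> rf imf rg img fg; rewrite /L2norm unlock; congr (_ `^ _)%E.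
have mn h : mRe h -> mIm h ->
    measurable_fun setT (fun x : R => `|(EFin \o (nc \o h)) x| `^ 2%R)%E.
  move=> r i; apply: (@measurableT_comp _ _ _ _ _ _ (fun y : \bar R => y `^ 2%R)%E).
    exact: measurable_poweR.
  by apply: measurableT_comp => //; apply/measurable_EFinP; exact: measurable_normc.
apply: ae_eq_integral => //; [exact: mn|exact: mn|].
apply: (@filterS _ _ (ae_filter_ringOfSetsType mu) _ _ _ fg) => x /= ->.
by [].
Qed.

Lemma L2_submod (z : R[i]) (f g : R -> R[i]) :
  L2 f -> L2 g -> L2 (fun x => z * f x + g x).
Proof.
move=> [rf imf nf] [rg img ng].
have mr : mRe (fun x => z * f x + g x).
  rewrite (_ : (fun _ => _) = (fun x => complex.Re z * complex.Re (f x) -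
      complex.Im z * complex.Im (f x) + complex.Re (g x))); last first.
    apply/funext => x; case: (z) (f x) (g x) => [a b] [c d] [e h].
    by rewrite /GRing.mul /GRing.add.
  apply: measurable_funD => //; apply: measurable_funB.
    exact: measurable_funM.
  exact: measurable_funM.
have mi : mIm (fun x => z * f x + g x).
  rewrite (_ : (fun _ => _) = (fun x => complex.Re z * complex.Im (f x) +
      complex.Im z * complex.Re (f x) + complex.Im (g x))); last first.
    apply/funext => x; case: (z) (f x) (g x) => [a b] [c d] [e h].
    by rewrite /GRing.mul /GRing.add.
  apply: measurable_funD => //; apply: measurable_funD.
    exact: measurable_funM.
  exact: measurable_funM.
split => //.
have inL h : L2 h -> nc \o h \in Lfun mu 2%:E.
  move=> [r i n]; apply/andP; split; last exact/mem_set.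
  by apply/mem_set; exact: measurable_normc.
have /andP[_] : nc z \*: (nc \o f) + (nc \o g) \in Lfun mu 2%:E.
  have [_ c] : submod_closed (Lfun mu 2%:E) by apply: Lfun_submod_closed; rewrite lee_fin ler1n.
  by apply: c; exact: inL.
rewrite inE /= /finite_norm; apply: le_lt_trans.
have hle x : nc (z * f x + g x) <= nc z * nc (f x) + nc (g x).
  by rewrite -ComplexField.Normc.normcM; exact: le_normcD.
have mn (h : R -> R) : measurable_fun setT h ->
    measurable_fun setT (fun x : R => `|(EFin \o h) x| `^ 2%R)%E.
  move=> hm; apply: (@measurableT_comp _ _ _ _ _ _ (fun y : \bar R => y `^ 2%R)%E).
    exact: measurable_poweR.
  by apply: measurableT_comp => //; apply/measurable_EFinP.
rewrite /L2norm unlock /=; apply: (@gt0_ler_poweR R 2^-1).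
- by rewrite invr_ge0.
- by rewrite in_itv /= leey andbT; apply: integral_ge0 => x _; rewrite lee_fin powR_ge0.
- by rewrite in_itv /= leey andbT; apply: integral_ge0 => x _; rewrite lee_fin powR_ge0.
apply: ge0_le_integral => //.
- by apply: mn; exact: measurable_normc.
- apply: (mn (nc z \*: (nc \o f) + (nc \o g))).
  apply: measurable_funD; last exact: measurable_normc.
  by apply: measurable_funM => //; exact: measurable_normc.
have nc0 y : 0 <= nc y by case: y => a b; exact: sqrtr_ge0.
move=> x _; rewrite lee_fin; apply: ge0_ler_powR; rewrite ?nnegrE //.
by rewrite !ger0_norm //; exact: le_trans (hle x).
Qed.

Lemma bcL2_0 : bcL2 (fun _ : R => 0).
Proof.
have L20 : L2 (fun _ : R => 0).
  split; [exact: measurable_cst|exact: measurable_cst|].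
  rewrite /L2norm (_ : _ \o _ = cst 0%E) ?Lnorm0 ?ltry //.
  by apply/funext => x /=; rewrite expr0n /= addr0 sqrtr0.
by split; rewrite /bc_hat1 /bc_hat2 /= ?(mulr0, subr0, addr0).
Qed.

Lemma bcL2_submod (w : bicomplex R) (u v : R -> bicomplex R) :
  bcL2 u -> bcL2 v -> bcL2 (fun x => w * u x + v x).
Proof.
move=> [u1 u2] [v1 v2]; split.
  by under eq_fun do rewrite bc_hat1_lin; exact: L2_submod.
by under eq_fun do rewrite bc_hat2_lin; exact: L2_submod.
Qed.

Lemma bcL2_norm_ae_eq (u v : R -> bicomplex R) : bcL2 u -> bcL2 v ->
  {ae mu, forall x, u x = v x} -> bcL2_norm u = bcL2_norm v.
Proof.
move=> [[? ? _] [? ? _]] [[? ? _] [? ? _]] uv; rewrite /bcL2_norm.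
by congr (_ * sqrte (_ ^+ 2 + _ ^+ 2))%E; apply: L2norm_ae_eq => //;
  apply: (@filterS _ _ (ae_filter_ringOfSetsType mu) _ _ _ uv) => x /= ->.
Qed.

Definition bcL2_expansion (phi : nat -> R -> bicomplex R)
    (u : R -> bicomplex R) (w : nat -> bicomplex R) : Prop :=
  bcL2_norm (fun x => u x - \sum_(l < n) w l * phi l x) @[n --> \oo] --> 0%E.

Definition hermite (l : nat) (t : R) : R :=
  (-1) ^+ l * expR (t ^+ 2) * derive1n l (fun s : R => expR (- s ^+ 2)) t.

Definition theta (m omega hbar xi x : R) : R :=
  Num.sqrt (m * omega / (hbar * xi)) * x.

Definition phi_hat (m omega hbar xi : R) (l : nat) (x : R) : R :=
  Num.sqrt (Num.sqrt (m * omega / (pi * hbar * xi)) * (2 ^+ l * l`!%:R)^-1) *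
  expR (- (theta m omega hbar xi x) ^+ 2 / 2) *
  hermite l (theta m omega hbar xi x).

(* The components of xi are meant to be positive reals: in the order of R[i],
   0 < z says that z is real and positive, and then Re z is z itself. *)
Definition phi (m omega hbar : R) (xi : bicomplex R) (l : nat) (x : R) :
    bicomplex R :=
  bc_e1 R * bcC (phi_hat m omega hbar (complex.Re (bc_hat1 xi)) l x)%:C%C +
  bc_e2 R * bcC (phi_hat m omega hbar (complex.Re (bc_hat2 xi)) l x)%:C%C.

End L2.

(* Main.v *)
Require Import Defs.
From mathcomp Require Import all_boot all_order all_algebra.
From mathcomp Require Import all_classical all_reals all_analysis.
From mathcomp Require Import complex measurable_realfun ring lra.
Import Order.TTheory GRing.Theory Num.Theory.
Import numFieldNormedType.Exports.
Local Open Scope classical_set_scope.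
Local Open Scope ring_scope.

(** The bicomplex problem splits into four real ones, the real and imaginary
    parts of the two idempotent components, so it is enough to show that, for
    K > 0, the Hermite functions [c_l H_l(sqrt K x) exp(-K x^2/2)] form an
    orthonormal system with dense span in the real L^2. An orthonormal system
    with dense span gives unique expansions by best approximation; completeness
    of L^2 is not needed.

    Orthonormality: the functional L(q) = int q(sqrt K x) exp(-K x^2) dx
    satisfies L(2 X q) = L(q'), hence L(H_(l+1) q) = L(H_l q'), and
    H_(l+1)' = 2 (l+1) H_l.

    Density of polynomials times the Gaussian g: let F be a bounded function such
    that F p g is in the L^2-closure for all polynomials p. By dominated
    convergence these F are stable under bounded pointwise limits, and, by the
    power series of sin, under multiplication by sin (a (x - b)). So they contain
    all polynomials in sin (a (x - b)), hence the indicators of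
    {sin (a (x - b)) > 0}, hence (a -> 0) those of half-lines, hence, by Dynkin's
    lemma, all indicators of measurable sets. Simple functions then approximate
    every square-integrable f as (simple function) * g. *)

(** * Square-integrable functions and L2-closures *)

Section SquareIntegrable.
Context {d : measure_display} {T : measurableType d} {R : realType}.
Variable mu : {measure set T -> \bar R}.
Implicit Types f g : T -> R.

Definition sqint f := measurable_fun setT f /\
  mu.-integrable setT (EFin \o (fun x => f x ^+ 2)).

Definition dot f g : R := \int[mu]_x (f x * g x).

Lemma sqint_le f g : measurable_fun setT f -> sqint g ->
  (forall x, `|f x| <= `|g x|) -> sqint f.
Proof.
move=> mf [mg ig] fg; split=> //; apply: le_integrable ig => //.
  by apply/measurable_EFinP; exact: measurable_funX.
by move=> x _; rewrite /= lee_fin !normrX lerXn2r ?nnegrE.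
Qed.

Lemma sqint_mul f g : sqint f -> sqint g ->
  mu.-integrable setT (EFin \o (fun x => f x * g x)).
Proof.
move=> [mf if2] [mg ig2].
have := @integrableD _ _ _ mu _ measurableT _ _ if2 ig2.
apply: le_integrable => //.
  by apply/measurable_EFinP; exact: measurable_funM.
move=> x _; rewrite /= lee_fin; rewrite [leRHS]ger0_norm ?addr_ge0 ?sqr_ge0 //.
by rewrite ler_norml; apply/andP; split; nra.
Qed.

Lemma sqintZ (a : R) f : sqint f -> sqint (fun x => a * f x).
Proof.
move=> [mf if2]; split; first exact: measurable_funM.
have := @integrableZl _ _ _ mu _ measurableT (a ^+ 2) _ if2.
by apply: eq_integrable => // x _ /=; rewrite -EFinM exprMn.
Qed.

Lemma sqintD f g : sqint f -> sqint g -> sqint (fun x => f x + g x).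
Proof.
move=> [mf if2] [mg ig2]; split; first exact: measurable_funD.
have := @integrableZl _ _ _ mu _ measurableT 2 _
  (@integrableD _ _ _ mu _ measurableT _ _ if2 ig2).
apply: le_integrable => //.
  by apply/measurable_EFinP; apply: measurable_funX; exact: measurable_funD.
move=> x _; rewrite /= lee_fin.
rewrite [leLHS]ger0_norm ?sqr_ge0 // [leRHS]ger0_norm; last first.
  by rewrite mulr_ge0 // addr_ge0 ?sqr_ge0.
by have := sqr_ge0 (f x - g x); nra.
Qed.

Lemma sqintB f g : sqint f -> sqint g -> sqint (fun x => f x - g x).
Proof.
move=> sf sg; have := sqintD _ _ sf (sqintZ (-1) _ sg).
by under eq_fun do rewrite mulN1r.
Qed.

Lemma sqint0 : sqint (fun=> 0).
Proof.
split; first exact: measurable_cst.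
have -> : EFin \o (fun _ : T => (0:R) ^+ 2) = cst 0%E.
  by apply/funext => x /=; rewrite expr0n.
exact: integrable0.
Qed.

Lemma sqint_sum (h : nat -> T -> R) (c : nat -> R) n :
  (forall l, sqint (h l)) -> sqint (fun x => \sum_(l < n) c l * h l x).
Proof.
move=> hh; elim: n => [|n ih].
  by under eq_fun do rewrite big_ord0; exact: sqint0.
under eq_fun do rewrite big_ord_recr /=.
by apply: sqintD => //; exact: sqintZ.
Qed.

Lemma dotC f g : dot f g = dot g f.
Proof. by apply: eq_Rintegral => x _; rewrite mulrC. Qed.

Lemma eq_dot f f' g g' : f =1 f' -> g =1 g' -> dot f g = dot f' g'.
Proof. by move=> ff gg; apply: eq_Rintegral => x _; rewrite ff gg. Qed.

Lemma dot_ge0 f : 0 <= dot f f.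
Proof. by apply: Rintegral_ge0 => x _; rewrite -expr2 sqr_ge0. Qed.

Lemma dotDl f g k : sqint f -> sqint g -> sqint k ->
  dot (fun x => f x + g x) k = dot f k + dot g k.
Proof.
move=> sf sg sk; rewrite -RintegralD //; [|exact: sqint_mul|exact: sqint_mul].
by apply: eq_Rintegral => x _; rewrite mulrDl.
Qed.

Lemma dotZl (a : R) f k : sqint f -> sqint k ->
  dot (fun x => a * f x) k = a * dot f k.
Proof.
move=> sf sk; rewrite -RintegralZl //; last exact: sqint_mul.
by apply: eq_Rintegral => x _; rewrite mulrA.
Qed.

Lemma dot_suml (h : nat -> T -> R) (c : nat -> R) n k :
  (forall l, sqint (h l)) -> sqint k ->
  dot (fun x => \sum_(l < n) c l * h l x) k = \sum_(l < n) c l * dot (h l) k.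
Proof.
move=> hh sk; elim: n => [|n ih].
  rewrite big_ord0 -[RHS](mul0r (dot (fun=> 0) k)) -dotZl //; last exact: sqint0.
  by apply: eq_dot => // x; rewrite big_ord0 mul0r.
rewrite big_ord_recr /= -ih -dotZl // -dotDl //.
- by apply: eq_dot => // x; rewrite big_ord_recr.
- exact: sqint_sum.
- exact: sqintZ.
Qed.

Lemma dotBl f g k : sqint f -> sqint g -> sqint k ->
  dot (fun x => f x - g x) k = dot f k - dot g k.
Proof.
move=> sf sg sk; rewrite -mulN1r -dotZl // -dotDl //; last exact: sqintZ.
by apply: eq_dot => // x; rewrite mulN1r.
Qed.

Lemma dotDD f g : sqint f -> sqint g ->
  dot (fun x => f x + g x) (fun x => f x + g x) =
  dot f f + 2 * dot f g + dot g g.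
Proof.
move=> sf sg; have sfg := sqintD _ _ sf sg.
rewrite dotDl // ![dot _ (fun x => f x + g x)]dotC !dotDl // [dot g f]dotC; ring.
Qed.

(** The square of [f - g] is nonnegative, which bounds the cross term. This stands in for the
    triangle inequality and keeps square roots away. *)
Lemma le_dotDD f g : sqint f -> sqint g ->
  dot (fun x => f x + g x) (fun x => f x + g x) <= 2 * dot f f + 2 * dot g g.
Proof.
move=> sf sg; have := dot_ge0 (fun x => f x + (-1) * g x).
rewrite !dotDD //; last exact: sqintZ.
rewrite [dot f (fun x => -1 * _)]dotC !dotZl //; last exact: sqintZ.
by rewrite [dot g (fun x => -1 * _)]dotC !dotZl // [dot g f]dotC; lra.
Qed.

Lemma integral_sqr f : sqint f ->
  (\int[mu]_x (f x ^+ 2)%:E)%E = (dot f f)%:E.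
Proof.
move=> [mf if2]; rewrite /dot /Rintegral.
by under [in RHS]eq_integral do rewrite -expr2; rewrite fineK // integrable_fin_num.
Qed.

Lemma dominated_sqint (f_ : nat -> T -> R) f g :
  (forall n, measurable_fun setT (f_ n)) -> measurable_fun setT f -> sqint g ->
  (forall n x, `|f_ n x| <= g x) ->
  (forall x, (f_ n x) @[n --> \oo] --> f x) ->
  sqint f /\
  dot (fun x => f x - f_ n x) (fun x => f x - f_ n x) @[n --> \oo] --> 0.
Proof.
move=> mf_ mf sg f_g f_f.
have fg x : `|f x| <= g x.
  apply: (@cvgr_to_le _ _ eventually_filter _ (fun n => `|f_ n x|)).
    exact: (cvg_norm (f_f x)).
  by apply: nearW.
have gn x : g x <= `|g x| by exact: ler_norm.
have sf : sqint f by apply: sqint_le sg _ => // x; exact: le_trans (gn x).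
have sf_ n : sqint (f_ n).
  by apply: sqint_le sg _ => // x; exact: le_trans (gn x).
split=> //.
have sD n : sqint (fun x => f x - f_ n x) by exact: sqintB.
(* Both [|f|] and [|f_ n|] are at most [g], so [4 g^2] dominates [(f - f_ n)^2]. *)
have ig2 := @integrableZl _ _ _ mu _ measurableT 4 _ sg.2.
pose F n x := ((f x - f_ n x) ^+ 2)%:E.
have mF n : measurable_fun setT (F n).
  by apply/measurable_EFinP; apply: measurable_funX; exact: (sD n).1.
have [||_ _] := @dominated_convergence _ _ _ mu _ measurableT F (cst 0%E) _ mF
  (measurable_cst _) _ ig2.
- apply: aeW => x _; rewrite /F; apply/fine_cvgP; split; first by apply: nearW.
  rewrite [X in X @ _ --> _](_ : _ = (fun n => (f x - f_ n x) * (f x - f_ n x))) //.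
  have -> : (0:R) = (f x - f x) * (f x - f x) by rewrite subrr mulr0.
  by apply: cvgM; apply: cvgB => //; exact: cvg_cst.
- apply: aeW => x n _; rewrite /F /= lee_fin ger0_norm ?sqr_ge0 //.
  have := fg x; have := f_g n x; rewrite !ler_norml => /andP[? ?] /andP[? ?].
  nra.
rewrite integral0 => /fine_cvgP[_]; apply: cvg_trans.
apply: near_eq_cvg; apply: nearW => n /=.
by rewrite integral_sqr.
Qed.

Variable S : set (T -> R).

(** Distances are squared. Requiring [sqint f] matters: the real-valued integral takes the value 0
    when the integral is infinite, which would make a distance look small. *)
Definition L2closure f := sqint f /\
  forall e : R, 0 < e -> exists2 g, S g & dot (fun x => f x - g x) (fun x => f x - g x) <= e.

Hypothesis Sint : forall g, S g -> sqint g.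
Hypothesis Slin : forall a g k, S g -> S k -> S (fun x => a * g x + k x).

Lemma L2closure_sub g : S g -> L2closure g.
Proof.
move=> Sg; split=> [|e e0]; first exact: Sint.
exists g => //; rewrite (eq_dot _ (fun=> 0) _ (fun=> 0)) => [|x|x]; rewrite ?subrr //.
by rewrite /dot mulr0 Rintegral_cst // mul0r ltW.
Qed.

Lemma L2closure_lin a f g : L2closure f -> L2closure g ->
  L2closure (fun x => a * f x + g x).
Proof.
move=> [sf cf] [sg cg]; split=> [|e e0].
  by apply: sqintD => //; exact: sqintZ.
(* Chosen so that [2 a^2 e / (4 (a^2 + 1)) + 2 e / 4 <= e]; the [+ 1] covers [a = 0]. *)
have [|f' Sf' ff'] := cf (e / (4 * (a ^+ 2 + 1))).
  by rewrite divr_gt0 // mulr_gt0 // ltr_wpDl ?sqr_ge0.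
have [|g' Sg' gg'] := cg (e / 4); first by rewrite divr_gt0.
exists (fun x => a * f' x + g' x); first exact: Slin.
have sff : sqint (fun x => f x - f' x) by apply: sqintB => //; exact: Sint.
have sgg : sqint (fun x => g x - g' x) by apply: sqintB => //; exact: Sint.
have saf := sqintZ a _ sff.
rewrite (eq_dot _ (fun x => a * (f x - f' x) + (g x - g' x)) _
  (fun x => a * (f x - f' x) + (g x - g' x))); last 2 first.
- by move=> x; ring.
- by move=> x; ring.
apply: le_trans (le_dotDD _ _ saf sgg) _.
rewrite dotZl // dotC dotZl //.
have : (a ^+ 2 + 1) * dot (fun x => f x - f' x) (fun x => f x - f' x) <= e / 4.
  rewrite mulrC -ler_pdivlMr ?ltr_wpDl ?sqr_ge0 //.
  by apply: le_trans ff' _; rewrite invfM mulrA.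
have := dot_ge0 (fun x => f x - f' x); nra.
Qed.

Lemma L2closure_lim (f_ : nat -> T -> R) f g :
  (forall n, L2closure (f_ n)) -> measurable_fun setT f -> sqint g ->
  (forall n x, `|f_ n x| <= g x) ->
  (forall x, (f_ n x) @[n --> \oo] --> f x) -> L2closure f.
Proof.
move=> cf_ mf sg f_g f_f.
have [sf fc] := dominated_sqint _ _ _ (fun n => (cf_ n).1.1) mf sg f_g f_f.
split=> // e e0.
have /cvgrPdist_le /(_ (e / 4)) := fc.
case; first by rewrite divr_gt0.
move=> N _ /(_ N (leqnn N)) /=; rewrite sub0r normrN ger0_norm ?dot_ge0 // => fN.
have [|k Sk kf] := (cf_ N).2 (e / 4); first by rewrite divr_gt0.
exists k => //.
have s1 : sqint (fun x => f x - f_ N x) by apply: sqintB => //; exact: (cf_ N).1.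
have s2 : sqint (fun x => f_ N x - k x).
  by apply: sqintB => //; [exact: (cf_ N).1|exact: Sint].
rewrite (eq_dot _ (fun x => (f x - f_ N x) + (f_ N x - k x)) _
  (fun x => (f x - f_ N x) + (f_ N x - k x))); last 2 first.
- by move=> x; ring.
- by move=> x; ring.
by apply: le_trans (le_dotDD _ _ s1 s2) _; lra.
Qed.

End SquareIntegrable.

(** * Orthonormal expansions *)

Section OrthonormalExpansion.
Context {d : measure_display} {T : measurableType d} {R : realType}.
Variable mu : {measure set T -> \bar R}.
Variable h : nat -> T -> R.
Hypothesis sh : forall l, sqint mu (h l).
Hypothesis orth : forall i j, dot mu (h i) (h j) = (i == j)%:R.
Local Notation dot := (dot mu).
Local Notation sqint := (sqint mu).

Definition residual (f : T -> R) (c : nat -> R) n x := f x - \sum_(l < n) c l * h l x.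

Let sres f c n : sqint f -> sqint (residual f c n).
Proof. by move=> sf; apply: sqintB => //; exact: sqint_sum. Qed.

Lemma dot_combination (c : nat -> R) n :
  dot (fun x => \sum_(l < n) c l * h l x) (fun x => \sum_(l < n) c l * h l x) =
  \sum_(l < n) c l ^+ 2.
Proof.
rewrite dot_suml //; last exact: sqint_sum.
apply: eq_bigr => i _; rewrite dotC dot_suml // (bigD1 i) //= orth eqxx mulr1.
rewrite big1 ?addr0 // => j ji; rewrite orth.
by rewrite (negbTE (_ : (j != i :> nat))) ?mulr0 //; apply: contraNneq ji => /ord_inj ->.
Qed.

(** Pythagoras: the residual for [c] is the Fourier residual, orthogonal to [h l] for [l < n], plus
    the combination with coefficients [dot f (h l) - c l]. Best approximation and uniqueness both
    follow. *)
Lemma residual_fourier (f : T -> R) (c : nat -> R) n : sqint f ->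
  dot (residual f c n) (residual f c n) =
  dot (residual f (fun l => dot f (h l)) n) (residual f (fun l => dot f (h l)) n) +
  \sum_(l < n) (dot f (h l) - c l) ^+ 2.
Proof.
move=> sf; set a := fun l => dot f (h l).
rewrite (eq_dot _ _ (fun x => residual f a n x + \sum_(l < n) (a l - c l) * h l x) _
  (fun x => residual f a n x + \sum_(l < n) (a l - c l) * h l x)); last 2 first.
1,2: move=> x; rewrite /residual -addrA -!sumrN -big_split /=; congr (_ + _);
  apply: eq_bigr => i _; ring.
rewrite dotDD; [|exact: sres|exact: (sqint_sum _ _ (fun l => a l - c l))].
rewrite (dot_combination (fun l => a l - c l)).
rewrite [X in _ + 2 * X + _]dotC (dot_suml _ _ (fun l => a l - c l)) //; last exact: sres.
rewrite big1 ?mulr0 ?addr0 // => i _; apply/eqP; rewrite mulf_eq0; apply/orP; right.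
rewrite dotC dotBl //; last exact: sqint_sum.
rewrite dot_suml // (bigD1 i) //= orth eqxx mulr1 big1 ?addr0 ?subrr // => j ji.
by rewrite orth (negbTE (_ : (j != i :> nat))) ?mulr0.
Qed.

Lemma residual_cvg0 (f : T -> R) : sqint f ->
  (forall e : R, 0 < e -> exists n c, dot (residual f c n) (residual f c n) <= e) ->
  let a l := dot f (h l) in
  dot (residual f a n) (residual f a n) @[n --> \oo] --> 0.
Proof.
move=> sf dense a; apply/cvgrPdist_le => e e0.
have [N [c Nc]] := dense e e0.
near=> n; rewrite sub0r normrN ger0_norm ?dot_ge0 //.
apply: le_trans Nc.
have Nn : (N <= n)%N by near: n; exact: nbhs_infty_ge.
(* Padding with zeros gives a combination of length [n] with the same residual, which the Fourier
   one cannot exceed. *)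
pose c' l := if (l < N)%N then c l else 0.
have E x : residual f c N x = residual f c' n x.
  rewrite /residual; congr (_ - _).
  rewrite -(big_mkord xpredT (fun l => c l * h l x)).
  rewrite -(big_mkord xpredT (fun l => c' l * h l x)).
  rewrite [RHS](big_cat_nat (n := N)) //=.
  rewrite [X in _ = _ + X]big_nat_cond [X in _ = _ + X]big1 ?addr0; last first.
    by move=> i; rewrite andbT /c' => /andP[]; rewrite leqNgt => /negbTE ->; rewrite mul0r.
  by rewrite big_nat_cond [RHS]big_nat_cond; apply: eq_bigr => i; rewrite andbT /c' /= => ->.
rewrite (eq_dot _ _ _ _ _ E E) (residual_fourier f c') // lerDl.
by apply: sumr_ge0 => i _; exact: sqr_ge0.
Unshelve. all: by end_near.
Qed.

(** For [n > k] the squared residual is at least [(dot f (h k) - c k)^2], so its convergence to 0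
    forces [c k] to be the Fourier coefficient. *)
Lemma expansion_unique (f : T -> R) (c c' : nat -> R) : sqint f ->
  dot (residual f c n) (residual f c n) @[n --> \oo] --> 0 ->
  dot (residual f c' n) (residual f c' n) @[n --> \oo] --> 0 -> c =1 c'.
Proof.
suff E c0 : sqint f -> dot (residual f c0 n) (residual f c0 n) @[n --> \oo] --> 0 ->
    forall k, dot f (h k) = c0 k by move=> sf Hc Hc' k; rewrite -!E.
move=> sf Hc k; apply/eqP; rewrite -subr_eq0 -sqrf_eq0 eq_le sqr_ge0 andbT.
apply: (@cvgr_to_ge _ _ eventually_filter _ _ _ _ Hc).
near=> n; rewrite residual_fourier //.
have kn : (k < n)%N by near: n; exact: nbhs_infty_gt.
rewrite (bigD1 (Ordinal kn)) //= addrCA lerDl addr_ge0 ?dot_ge0 //.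
by apply: sumr_ge0 => i _; exact: sqr_ge0.
Unshelve. all: by end_near.
Qed.

End OrthonormalExpansion.

(** * Gaussian weights *)

Section GaussianWeight.
Context {R : realType}.
Local Notation mu := (@lebesgue_measure R).

Definition gauss (c x : R) : R := expR (- (c * x ^+ 2)).

Lemma gauss_gt0 c x : 0 < gauss c x. Proof. exact: expR_gt0. Qed.

Lemma measurable_gauss c : measurable_fun setT (gauss c).
Proof.
apply: measurableT_comp => //; apply: measurableT_comp => //.
by apply: measurable_funM => //; exact: measurable_funX.
Qed.

(** The variance [1 / (2c)] turns the centred normal density into a multiple of [gauss c];
    integrability and the integral [sqrt (pi / c)] come from there. *)
Lemma normal_pdf_gauss c : 0 < c ->
  normal_pdf 0 (Num.sqrt (2 * c)^-1) = (fun x => (Num.sqrt (pi / c))^-1 * gauss c x).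
Proof.
move=> c0; have s0 : Num.sqrt (2 * c)^-1 != 0 :> R.
  by rewrite sqrtr_eq0 -ltNge invr_gt0 mulr_gt0.
have cn : c != 0 by rewrite gt_eqF.
rewrite normal_pdfE //; apply/funext => x; rewrite /normal_peak /normal_fun /gauss.
rewrite sqr_sqrtr ?invr_ge0 ?mulr_ge0 ?ltW // subr0; congr (_ ^-1 * expR _).
  by congr Num.sqrt; rewrite -mulr_natr; field.
by rewrite -mulr_natr; field.
Qed.

Lemma integrable_gauss c : 0 < c -> mu.-integrable setT (EFin \o gauss c).
Proof.
move=> c0; have := integrable_normal_pdf 0 (Num.sqrt (2 * c)^-1).
rewrite normal_pdf_gauss // => /(@integrableZl _ _ _ mu _ measurableT (Num.sqrt (pi / c))).
apply: eq_integrable => // x _; rewrite /= -EFinM mulrA divff ?mul1r //.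
by rewrite sqrtr_eq0 -ltNge divr_gt0 // pi_gt0.
Qed.

Lemma integral_gauss c : 0 < c -> \int[mu]_x gauss c x = Num.sqrt (pi / c).
Proof.
move=> c0; have := integral_normal_pdf 0 (Num.sqrt (2 * c)^-1).
rewrite normal_pdf_gauss // => /(congr1 fine).
rewrite -/(Rintegral _ _ _) RintegralZl //; last exact: integrable_gauss.
move=> /(congr1 (fun y => Num.sqrt (pi / c) * y)).
rewrite mulrA divff ?mul1r ?mulr1 //.
by rewrite sqrtr_eq0 -ltNge divr_gt0 // pi_gt0.
Qed.

(** Completing the square bounds [k |x| - (c - c') x^2] by [k^2 / (4 (c - c'))]: lowering the rate
    of the Gaussian absorbs exponential growth. *)
Lemma expR_mul_gauss_le (k c c' x : R) : c' < c ->
  expR (k * `|x|) * gauss c x <= expR (k ^+ 2 / (4 * (c - c'))) * gauss c' x.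
Proof.
move=> cc; have e0 : 0 < 4 * (c - c') by rewrite mulr_gt0 // subr_gt0.
rewrite /gauss -!expRD ler_expR -lerBlDr -(ler_pM2r e0) divfK ?gt_eqF //.
have -> : x ^+ 2 = `|x| ^+ 2 by rewrite real_normK // num_real.
have := sqr_ge0 (2 * (c - c') * `|x| - k); nra.
Qed.

Lemma sqint_expR_gauss (k c : R) : 0 < c ->
  sqint mu (fun x : R => expR (k * `|x|) * gauss c x).
Proof.
move=> c0.
have mf : measurable_fun setT (fun x : R => expR (k * `|x|) * gauss c x).
  apply: measurable_funM; last exact: measurable_gauss.
  by apply: measurableT_comp => //; apply: measurable_funM => //; exact: measurableT_comp.
split=> //.
have := @integrableZl _ _ _ mu _ measurableT
  (expR ((2 * k) ^+ 2 / (4 * (2 * c - c)))) _ (integrable_gauss _ c0).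
apply: le_integrable => //.
  by apply/measurable_EFinP; exact: measurable_funX.
move=> x _; rewrite /= lee_fin [leLHS]ger0_norm ?sqr_ge0 //.
rewrite [leRHS]ger0_norm ?mulr_ge0 ?expR_ge0 //.
apply: le_trans (expR_mul_gauss_le _ _ _ _ _); last by lra.
by rewrite /gauss exprMn -!expRM_natl -!expRD ler_expR le_eqVlt; apply/orP; left; apply/eqP; ring.
Qed.

(** Each factor [X] is paid for by [|x| <= expR |x|], which raises the exponent by 1; [|k|] keeps
    the exponent nonnegative, so that it also covers the constant term. *)
Lemma horner_le_expR (p : {poly R}) :
  exists C k, 0 <= C /\ forall x, `|p.[x]| <= C * expR (k * `|x|).
Proof.
elim/poly_ind: p => [|p a [C [k [C0 Ck]]]].
  by exists 0, 0; split=> // x; rewrite horner0 normr0 mul0r.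
exists (C + `|a|), (`|k| + 1); split=> [|x]; first by rewrite addr_ge0.
rewrite hornerMXaddC; apply: le_trans (ler_normD _ _) _; rewrite mulrDl.
apply: lerD.
  rewrite normrM mulrDl mul1r expRD mulrA; apply: ler_pM => //.
    apply: le_trans (Ck x) _; apply: ler_wpM2l => //.
    by rewrite ler_expR ler_wpM2r // ler_norm.
  by apply: le_trans (expR_ge1Dx _); rewrite lerDr.
rewrite -[leLHS]mulr1; apply: ler_wpM2l => //; rewrite -expR0 ler_expR.
by rewrite mulr_ge0 // addr_ge0.
Qed.

Lemma measurable_horner (p : {poly R}) : measurable_fun setT (horner p).
Proof. by apply: continuous_measurable_fun; exact: continuous_horner. Qed.

Lemma sqint_horner_gauss c (p : {poly R}) : 0 < c ->
  sqint mu (fun x : R => p.[x] * gauss c x).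
Proof.
move=> c0; have [C [k [C0 Ck]]] := horner_le_expR p.
apply: sqint_le (sqintZ mu C _ (sqint_expR_gauss k _ c0)) _.
  by apply: measurable_funM; [exact: measurable_horner|exact: measurable_gauss].
move=> x; rewrite !normrM mulrA; apply: ler_wpM2r => //.
by rewrite [`|C|]ger0_norm // [`|expR _|]ger0_norm ?expR_ge0 //; exact: Ck.
Qed.

End GaussianWeight.

(** * Step polynomials, slow sines and the sine series *)

Section HalfLineApproximation.
Context {R : realType}.

Lemma natr_mul_expr_cvg0 (r : R) : 0 <= r < 1 -> n%:R * r ^+ n @[n --> \oo] --> 0.
Proof.
move=> /andP[r0 r1]; have [->|rn0] := eqVneq r 0.
  apply: cvg_near_cst; near=> n; apply/eqP; rewrite expr0n.
  rewrite (_ : n == 0%N = false) ?mulr0 //; apply/negbTE; rewrite -lt0n.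
  by near: n; exact: nbhs_infty_gt.
have rp : 0 < r by rewrite lt_def rn0.
(* With [r = expR (- y)], the bound [(n y)^2 / 2 <= expR (n y)] gives [n r^n <= 2 / (y^2 n)]. *)
pose y := - ln r; have y0 : 0 < y by rewrite oppr_gt0 ln_lt0 // rp.
have ry : r = expR (- y) by rewrite /y opprK lnK.
apply: (@squeeze_cvgr _ _ _ _ (cst 0) (fun n => (2 / y ^+ 2) * n%:R^-1)).
- near=> n; rewrite mulr_ge0 ?exprn_ge0 //=.
  have n0 : 0 < n%:R :> R by rewrite ltr0n; near: n; exact: nbhs_infty_gt.
  rewrite ry -expRM_natl mulrN expRN ler_pdivrMr ?expR_gt0 //.
  rewrite [leLHS](_ : _ = 2 / y ^+ 2 / n%:R * ((n%:R * y) ^+ 2 / 2)); last first.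
    by field; rewrite !gt_eqF.
  apply: ler_wpM2l; first by rewrite !mulr_ge0 ?invr_ge0 ?exprn_ge0 ?ltW.
  have := @expR_ge1Dxn _ (n%:R * y) 1 (mulr_ge0 (ltW n0) (ltW y0)).
  by apply: le_trans; rewrite lerDr.
- exact: cvg_cst.
- rewrite -[X in _ --> X](mulr0 (2 / y ^+ 2)); apply: cvgM; first exact: cvg_cst.
  apply/gtr0_cvgV0; last exact: cvgr_idn.
  by near=> n; rewrite ltr0n; near: n; exact: nbhs_infty_gt.
Unshelve. all: by end_near.
Qed.

Lemma bernoulli_le (y : R) n : 0 <= y <= 1 -> 1 - n%:R * y <= (1 - y) ^+ n.
Proof.
move=> /andP[y0 y1]; elim: n => [|n ih]; first by rewrite mul0r subr0.
rewrite exprS; have : (1 - y) * (1 - n%:R * y) <= (1 - y) * (1 - y) ^+ n.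
  by apply: ler_wpM2l => //; rewrite subr_ge0.
apply: le_trans; rewrite -natr1.
have : 0 <= n%:R * y * y by rewrite !mulr_ge0.
nra.
Qed.

(* A variant of the Brosowski-Deutsch polynomials; the extra factor [n] in the
   exponent makes the value at [s = 1/2] converge to [0]. *)
Lemma step_polynomial_cvg (s : R) : 0 <= s <= 1 ->
  (1 - s ^+ n) ^+ (n * 2 ^ n) @[n --> \oo] --> ((s < 2^-1)%R%:R : R).
Proof.
move=> /andP[s0 s1].
have sn n : 0 <= s ^+ n <= 1 by rewrite exprn_ge0 //= exprn_ile1.
have [s2|s2] := ltP s 2^-1.
(* Bernoulli's inequality gives the lower bound, which tends to 1 since [2 s < 1]. *)
- apply: (@squeeze_cvgr _ _ _ _ (fun n => 1 - n%:R * (2 * s) ^+ n) (cst 1)).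
  + near=> n; apply/andP; split; last first.
      have /andP[? ?] := sn n.
      by rewrite exprn_ile1 ?subr_ge0 // lerBlDr lerDl.
    by apply: le_trans (bernoulli_le _ _ (sn n)); rewrite natrM natrX exprMn mulrA.
  + rewrite -[X in _ --> X]subr0; apply: cvgB; first exact: cvg_cst.
    by apply: natr_mul_expr_cvg0; lra.
  + exact: cvg_cst.
(* Here [1 - s^n <= expR (- 2^-n)], so the power is at most [expR (- n) <= 1 / (n + 1)]. *)
- apply: (@squeeze_cvgr _ _ _ _ (cst 0) (@harmonic R)).
  + near=> n; have /andP[sn0 sn1] := sn n.
    rewrite exprn_ge0 ?subr_ge0 //=.
    have h1 : 1 - s ^+ n <= expR (- 2^-1 ^+ n).
      apply: le_trans (expR_ge1Dx _); rewrite lerD2l lerN2.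
      by apply: lerXn2r; rewrite ?nnegrE.
    apply: (@le_trans _ _ (expR (- 2^-1 ^+ n) ^+ (n * 2 ^ n))).
      by apply: lerXn2r; rewrite ?nnegrE ?subr_ge0 ?expR_ge0.
    rewrite -expRM_natl natrM natrX mulrN -mulrA exprVn divff ?expf_neq0 // mulr1.
    rewrite expRN /= lef_pV2 ?posrE ?expR_gt0 ?ltr0n //.
    by apply: le_trans (expR_ge1Dx _); rewrite -natr1 addrC.
  + exact: cvg_cst.
  + exact: cvg_harmonic.
Unshelve. all: by end_near.
Qed.

(** Once [|y| / (n + 1) < pi], the argument lies where [sin] has the sign of its argument.
    Frequencies tending to 0 thus turn periodic indicators into those of half-lines. *)
Lemma sin_scaled_sign (y : R) :
  \forall n \near \oo, (0 < sin (n.+1%:R^-1 * y)) = (0 < y).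
Proof.
near=> n.
have n0 : 0 < n.+1%:R^-1 :> R by rewrite invr_gt0 ltr0n.
have small : n.+1%:R^-1 * `|y| < pi.
  rewrite mulrC ltr_pdivrMr ?ltr0n //.
  have h : `|y| / pi < n.+1%:R.
    by apply: (@lt_trans _ _ n%:R); [near: n; exact: nbhs_infty_gtr|rewrite ltr_nat].
  by move: h; rewrite ltr_pdivrMr ?pi_gt0 // mulrC.
have [y0|y0] := ltP 0 y.
  by rewrite sin_gt0_pi // mulr_gt0 //=; move: small; rewrite gtr0_norm.
apply/negbTE; rewrite -leNgt -oppr_ge0 -sinN -mulrN; apply: sin_ge0_pi.
rewrite mulr_ge0 ?oppr_ge0 ?(ltW n0) //=.
by move: small; rewrite ler0_norm // => /ltW.
Unshelve. all: by end_near.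
Qed.

(** The bound is uniform in [n], as a dominating function for the partial sums must be. *)
Lemma norm_series_sin_coeff (y : R) n : `|series (sin_coeff y) n| <= expR `|y|.
Proof.
apply: (@le_trans _ _ (series (exp_coeff `|y|) n)).
  rewrite /series /=; apply: le_trans (ler_norm_sum _ _ _) _.
  apply: ler_sum => i _; rewrite /sin_coeff /exp_coeff /=.
  rewrite !normrM normfV !normr_nat !normrX normrN1 expr1n mulr1.
  apply: ler_wpM2r; first by rewrite invr_ge0.
  by apply: ler_piMl; [exact: exprn_ge0|case: odd].
rewrite /expR; apply: nondecreasing_cvgn_le; last exact: is_cvg_series_exp_coeff.
by apply: nondecreasing_series => i _ _; rewrite /exp_coeff /= divr_ge0 ?exprn_ge0.
Qed.

End HalfLineApproximation.

(** * Density of polynomials times a Gaussian *)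

Section GaussianDensity.
Context {R : realType}.
Variables (c : R) (c_gt0 : 0 < c).
Local Notation mu := (@lebesgue_measure R).

Definition poly_gauss : set (R -> R) :=
  [set f | exists p : {poly R}, f = (fun x => p.[x] * gauss c x)].

Lemma poly_gauss_sqint f : poly_gauss f -> sqint mu f.
Proof. by move=> [p ->]; exact: sqint_horner_gauss. Qed.

Lemma poly_gauss_lin a f g : poly_gauss f -> poly_gauss g ->
  poly_gauss (fun x => a * f x + g x).
Proof.
move=> [p ->] [q ->]; exists (a *: p + q); apply/funext => x.
by rewrite hornerD hornerZ; ring.
Qed.

Local Notation closed f := (L2closure mu poly_gauss f).

(* Quantifying over all polynomials [p] is what makes the class stable under
   multiplication by [sin (a (x - b))], through the power series of [sin]. *)
Definition multiplier (F : R -> R) := [/\ measurable_fun setT F,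
  exists C, forall x, `|F x| <= C &
  forall p : {poly R}, closed (fun x => F x * p.[x] * gauss c x)].

Lemma eq_multiplier F G : F =1 G -> multiplier F -> multiplier G.
Proof. by move=> /funext ->. Qed.

Lemma multiplier1 : multiplier (fun=> 1).
Proof.
split; [exact: measurable_cst|by exists 1 => x; rewrite normr1|move=> p].
apply: L2closure_sub; first exact: poly_gauss_sqint.
by exists p; apply/funext => x; rewrite mul1r.
Qed.

Lemma multiplier_lin a F G : multiplier F -> multiplier G -> multiplier (fun x => a * F x + G x).
Proof.
move=> [mF [C FC] cF] [mG [D GD] cG]; split.
- by apply: measurable_funD => //; exact: measurable_funM.
- exists (`|a| * C + D) => x; apply: le_trans (ler_normD _ _) _.
  by apply: lerD => //; rewrite normrM; exact: ler_wpM2l.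
- move=> p.
  have -> : (fun x => (a * F x + G x) * p.[x] * gauss c x) =
    (fun x => a * (F x * p.[x] * gauss c x) + G x * p.[x] * gauss c x).
    by apply/funext => x; ring.
  by apply: L2closure_lin => //; [exact: poly_gauss_sqint|exact: poly_gauss_lin].
Qed.

Lemma multiplier_lim (F_ : nat -> R -> R) (F : R -> R) (C : R) : (forall n, multiplier (F_ n)) ->
  (forall n x, `|F_ n x| <= C) -> (forall x, F_ n x @[n --> \oo] --> F x) ->
  multiplier F.
Proof.
move=> gF_ F_C F_F.
have mF : measurable_fun setT F.
  apply: (@measurable_fun_cvg _ _ _ _ F_) => [n|x _]; last exact: F_F.
  by have [] := gF_ n.
split=> //.
  exists C => x; apply: (@cvgr_to_le _ _ eventually_filter _ (fun n => `|F_ n x|)).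
    exact: (cvg_norm (F_F x)).
  by apply: nearW.
move=> p.
apply: (@L2closure_lim _ _ _ mu _ poly_gauss_sqint
  (fun n x => F_ n x * p.[x] * gauss c x) _ (fun x => C * `|p.[x] * gauss c x|)).
- by move=> n; have [_ _] := gF_ n.
- apply: measurable_funM; last exact: measurable_gauss.
  by apply: measurable_funM => //; exact: measurable_horner.
- apply: sqintZ; apply: sqint_le (sqint_horner_gauss _ p c_gt0) _ => [|x]; last first.
    by rewrite normr_id.
  by apply: measurableT_comp => //; exact: (sqint_horner_gauss _ p c_gt0).1.
- by move=> n x; rewrite -mulrA normrM; exact: ler_wpM2r.
- move=> x; apply: cvgM; last exact: cvg_cst.
  by apply: cvgM; [exact: F_F|exact: cvg_cst].
Qed.

(** The partial sums [P N] of the sine series are polynomials in [x], so the hypothesis on [F]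
    applies to [p * P N]; dominated convergence does the rest. *)
Lemma multiplier_sin a b F : multiplier F -> multiplier (fun x => F x * sin (a * (x - b))).
Proof.
move=> [mF [C FC] cF].
have C0 : 0 <= C by exact: le_trans (FC 0).
have ms : measurable_fun setT (fun x : R => sin (a * (x - b))).
  apply: measurableT_comp; first by apply: continuous_measurable_fun; exact: continuous_sin.
  by apply: measurable_funM => //; exact: measurable_funB.
split; first exact: measurable_funM.
  exists C => x; rewrite normrM -[leRHS]mulr1; apply: ler_pM => //.
  by rewrite ler_norml sin_geN1 sin_le1.
move=> p.
pose P N : {poly R} := \sum_(0 <= i < N)
  ((odd i)%:R * (-1) ^+ i.-1./2 / i`!%:R) *: (a *: ('X - b%:P)) ^+ i.
have PE N x : (P N).[x] = series (sin_coeff (a * (x - b))) N.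
  rewrite /P horner_sum; apply: eq_bigr => i _.
  by rewrite hornerZ horner_exp hornerZ hornerXsubC /sin_coeff /= mulrAC.
have [D [k [D0 Dk]]] := horner_le_expR p.
(* The dominating function multiplies the bounds [C] of [|F|], [D expR (k |x|)] of [|p|] and
   [expR (|a| |b|) expR (|a| |x|)] of [|P N|]. *)
apply: (@L2closure_lim _ _ _ mu _ poly_gauss_sqint
  (fun N x => F x * (p * P N).[x] * gauss c x) _
  (fun x => C * D * expR (`|a| * `|b|) * (expR ((k + `|a|) * `|x|) * gauss c x))).
- by move=> N; exact: cF.
- apply: measurable_funM; last exact: measurable_gauss.
  by apply: measurable_funM; [exact: measurable_funM|exact: measurable_horner].
- exact/sqintZ/sqint_expR_gauss.
- move=> N x; rewrite hornerM PE !normrM mulrA [`|gauss _ _|]gtr0_norm ?gauss_gt0 //.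
  rewrite mulrA; apply: ler_wpM2r; first exact/ltW/gauss_gt0.
  rewrite mulrDl expRD.
  have -> : C * D * expR (`|a| * `|b|) * (expR (k * `|x|) * expR (`|a| * `|x|)) =
    C * (D * expR (k * `|x|)) * (expR (`|a| * `|b|) * expR (`|a| * `|x|)) by ring.
  apply: ler_pM; [by rewrite mulr_ge0|by []|by apply: ler_pM|].
  apply: le_trans (norm_series_sin_coeff _ _) _.
  rewrite -expRD ler_expR normrM -mulrDr ler_wpM2l // [leRHS]addrC.
  exact: ler_normB.
- move=> x; apply: cvgM; last exact: cvg_cst.
  rewrite -mulrA [X in _ * X]mulrC; apply: cvgM; first exact: cvg_cst.
  under eq_fun do rewrite hornerM PE.
  apply: cvgM; first exact: cvg_cst.
  by rewrite unlock; exact: is_cvg_series_sin_coeff.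
Qed.

Lemma multiplier_poly_sin a b (q : {poly R}) : multiplier (fun x => q.[sin (a * (x - b))]).
Proof.
elim/poly_ind: q => [|q e gq].
  (* [multiplier_lin] forms [a * F + G], so 0 is written [-1 * 1 + 1]; likewise [e] is
     [(e - 1) * 1 + 1] below. *)
  apply: eq_multiplier (multiplier_lin (-1) _ _ multiplier1 multiplier1) => x.
  by rewrite horner0 mulN1r addNr.
have ge := multiplier_lin (e - 1) _ _ multiplier1 multiplier1.
apply: eq_multiplier (multiplier_lin 1 _ _ (multiplier_sin a b _ gq) ge) => x.
by rewrite hornerMXaddC; ring.
Qed.

(** The affine change [s] maps the values of [sin] into [[0, 1]], with [sin > 0] exactly when
    [s < 1/2]; the step polynomials in [s] stay in [[0, 1]] and converge to the indicator. *)
Lemma multiplier_sin_pos a b : multiplier (fun x => (0 < sin (a * (x - b)))%R%:R).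
Proof.
pose s x : R := (1 - sin (a * (x - b))) / 2.
have s01 x : 0 <= s x <= 1.
  by have := sin_le1 (a * (x - b)); have := sin_geN1 (a * (x - b)); rewrite /s; lra.
pose q n : {poly R} := (1 - (2^-1 *: (1 - 'X)) ^+ n) ^+ (n * 2 ^ n).
apply: (@multiplier_lim (fun n x => (q n).[sin (a * (x - b))]) _ 1).
- by move=> n; exact: multiplier_poly_sin.
- move=> n x; rewrite /q !(hornerE, horner_exp) [2^-1 * _]mulrC -/(s x).
  have /andP[s0 s1] := s01 x.
  have h0 : 0 <= 1 - s x ^+ n by rewrite subr_ge0 exprn_ile1.
  by rewrite ger0_norm ?exprn_ge0 // exprn_ile1 // lerBlDr lerDl exprn_ge0.
- move=> x; have -> : (0 < sin (a * (x - b))) = (s x < 2^-1).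
    by rewrite /s; apply/idP/idP => ?; lra.
  rewrite [X in X @ _ --> _](_ : _ = fun n => (1 - s x ^+ n) ^+ (n * 2 ^ n)).
    exact: step_polynomial_cvg.
  by apply/funext => n; rewrite /q !(hornerE, horner_exp) [2^-1 * _]mulrC.
Qed.

Lemma multiplier_halfline b : multiplier (fun x => (b < x)%R%:R).
Proof.
apply: (@multiplier_lim (fun n x => (0 < sin (n.+1%:R^-1 * (x - b)))%R%:R) _ 1).
- by move=> n; exact: multiplier_sin_pos.
- by move=> n x; case: (0 < _); rewrite ?normr1 ?normr0.
- move=> x; apply: cvg_near_cst.
  by apply: filterS (sin_scaled_sign (x - b)) => n ->; rewrite subr_gt0.
Qed.

(** Open half-lines are stable under intersection and generate the Borel sets. Complements use
    [1 - \1_B], disjoint unions a bounded limit of partial sums. *)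
Lemma multiplier_indic (A : set R) : measurable A -> multiplier \1_A.
Proof.
rewrite [X in X A -> _](RGenOInfty.measurableE R).
apply: (@dynkin_induction _ (measurableTypeR R) (@RGenOInfty.G R) (fun B => multiplier \1_B)).
- exact: RGenOInfty.measurableE.
- move=> _ _ [x ->] [y ->]; exists (Num.max x y).
  by apply/seteqP; split => z /=; rewrite !in_itv /= !andbT gt_max => /andP.
- by rewrite indicT; exact: multiplier1.
- move=> _ [x ->]; apply: eq_multiplier (multiplier_halfline x) => y.
  rewrite indicE; have -> // : (y \in [set` `]x, +oo[]) = (x < y).
  by apply/idP/idP => [/set_mem /=|h];
    [rewrite in_itv /= andbT|apply/mem_set; rewrite /= in_itv /= h].
- move=> B _ gB; apply: eq_multiplier (multiplier_lin (-1) _ _ gB multiplier1) => x.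
  by rewrite indicC indicE; case: (x \in B); rewrite /= ?mulr1 ?mulr0 ?addNr ?add0r.
- move=> F _ tF gF.
  have gS n : multiplier (fun x => \sum_(0 <= k < n) \1_(F k) x).
    elim: n => [|n ih].
      apply: eq_multiplier (multiplier_lin (-1) _ _ multiplier1 multiplier1) => x.
      by rewrite big_nil mulN1r addNr.
    apply: eq_multiplier (multiplier_lin 1 _ _ ih (gF n)) => x.
    by rewrite big_nat_recr //= mul1r.
  have lS x : \sum_(0 <= k < n) \1_(F k) x @[n --> \oo] --> (\1_(\bigcup_k F k) x : R).
    have := @is_cvg_nneseries R (fun k => (\1_(F k) x)%:E) xpredT 0%N
      (fun k _ _ => ltac:(by rewrite lee_fin)).
    rewrite -(indic_bigcup _ tF) => /fine_cvgP[_].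
    apply: cvg_trans; apply: near_eq_cvg; apply: nearW => n /=.
    by rewrite sumEFin.
  apply: (@multiplier_lim _ _ 1 gS _ lS) => n x.
  rewrite ger0_norm ?sumr_ge0 //.
  (* The partial sums are nondecreasing, hence below their limit, an indicator. *)
  apply: le_trans (_ : \1_(\bigcup_k F k) x <= 1); last by rewrite indicE lern1 leq_b1.
  apply: (@cvgr_to_ge _ _ eventually_filter _ _ _ _ (lS x)).
  near=> N; have nN : (n <= N)%N by near: N; exact: nbhs_infty_ge.
  by rewrite [leRHS](big_cat_nat (n := n)) //= lerDl sumr_ge0.
Unshelve. all: by end_near.
Qed.

Lemma multiplier_sum (I : Type) (s : seq I) (a : I -> R) (F : I -> R -> R) :
  (forall i, multiplier (F i)) -> multiplier (fun x => \sum_(i <- s) a i * F i x).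
Proof.
move=> gF; elim: s => [|i s ih].
  apply: eq_multiplier (multiplier_lin (-1) _ _ multiplier1 multiplier1) => x.
  by rewrite big_nil mulN1r addNr.
by apply: eq_multiplier (multiplier_lin (a i) _ _ (gF i) ih) => x; rewrite big_cons.
Qed.

Import HBNNSimple.

(** Simple functions increasing to [f / gauss c] are multipliers; times the Gaussian they converge
    to [f] and are dominated by [f] itself. *)
Lemma ge0_poly_gauss_dense (f : R -> R) : sqint mu f -> (forall x, 0 <= f x) -> closed f.
Proof.
move=> sf f0.
pose G x := (f x / gauss c x)%:E.
have mG : measurable_fun setT G.
  apply/measurable_EFinP; apply: measurable_funM; first exact: sf.1.
  under eq_fun do rewrite /gauss -expRN opprK.
  by apply: measurableT_comp => //; apply: measurable_funM => //; exact: measurable_funX.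
have G0 x : (0 <= G x)%E by rewrite lee_fin divr_ge0 // ltW // gauss_gt0.
pose s n := nnsfun_approx measurableT mG n.
have sG n x : s n x <= f x / gauss c x.
  by rewrite -lee_fin /s nnsfun_approxE; exact: le_approx.
apply: (@L2closure_lim _ _ _ mu _ poly_gauss_sqint (fun n x => s n x * gauss c x) _ f).
- move=> n; have : multiplier (s n).
    apply: eq_multiplier (multiplier_sum _ (finmap.enum_fset (fset_set (range (s n)))) id
      (fun y => \1_(s n @^-1` [set y])) _) => [x|y].
      by rewrite [RHS]fimfunE fsbig_finite.
    apply: multiplier_indic; rewrite -[X in measurable X]setTI.
    exact: (measurable_funP (s n)).
  case=> _ _ /(_ 1).
  by under eq_fun do rewrite hornerC mulr1.
- exact: sf.1.
- exact: sf.
- move=> n x; rewrite ger0_norm; last by rewrite mulr_ge0 // ltW // gauss_gt0.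
  by rewrite -ler_pdivlMr ?gauss_gt0.
- move=> x; rewrite -[X in _ --> X](@divfK _ (gauss c x)) ?gt_eqF ?gauss_gt0 //.
  apply: cvgM; last exact: cvg_cst.
  have /fine_cvgP[_] := @cvg_nnsfun_approx _ _ _ _ measurableT _ mG (fun x _ => G0 x) x I.
  exact.
Qed.

Theorem poly_gauss_dense (f : R -> R) : sqint mu f -> closed f.
Proof.
move=> sf.
have smax k : sqint mu k -> sqint mu (fun x => Num.max (k x) 0).
  move=> sk; apply: sqint_le (sk) _ => [|x].
    by apply: measurable_maxr; [exact: sk.1|exact: measurable_cst].
  by rewrite /Order.max; case: ifP => // _; rewrite normr0.
have -> : f = (fun x => (-1) * Num.max (- 1 * f x) 0 + Num.max (f x) 0).
  by apply/funext => x; rewrite mulN1r; case: (leP (f x) 0) => ?;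
    rewrite /Order.max; case: ifP => ?; lra.
apply: L2closure_lin; [exact: poly_gauss_sqint|exact: poly_gauss_lin|..];
  apply: ge0_poly_gauss_dense => [|x]; rewrite ?le_max ?lexx ?orbT //; apply: (smax) => //.
exact: sqintZ.
Qed.

End GaussianDensity.

(** * Integration by parts against a Gaussian *)

Section GaussianIntegrationByParts.
Context {R : realType}.
Local Notation mu := (@lebesgue_measure R).

Lemma is_derive_poly_gauss (c : R) (p : {poly R}) (x : R) :
  is_derive x (1 : R) (fun x => p.[x] * gauss c x)
    ((p^`() - (2 * c) *: ('X * p)).[x] * gauss c x).
Proof.
have gE : gauss c = expR \o horner (- (c *: 'X^2)).
  by apply/funext => y; rewrite /gauss /= hornerN hornerZ hornerXn.
have dg : is_derive x (1 : R) (gauss c) (- (2 * c * x) * gauss c x).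
  rewrite gE; apply: is_derive_eq; rewrite /= mulrC; congr (_ * _).
  by rewrite derivN derivZ derivXn hornerN hornerZ hornerMn hornerXn; ring.
apply: (@is_derive_eq _ _ _ (horner p * gauss c)); rewrite /GRing.scale /=.
by rewrite hornerD hornerN hornerZ hornerM hornerX; ring.
Qed.

(** Splitting the Gaussian into two of rate [c / 2] makes the integrand a product of two
    square-integrable functions. *)
Lemma integrable_poly_gauss (c : R) (p : {poly R}) : 0 < c ->
  mu.-integrable setT (EFin \o (fun x => p.[x] * gauss c x)).
Proof.
move=> c0; have c20 : 0 < c / 2 by rewrite divr_gt0.
have := sqint_mul mu _ _ (sqint_horner_gauss _ p c20) (sqint_horner_gauss _ 1 c20).
apply: eq_integrable => // x _ /=; rewrite hornerC mul1r -mulrA -expRD; congr ((_ * expR _)%:E).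
by field.
Qed.

(** The sign [s] treats both ends of the line at once. Halving the rate absorbs the polynomial, and
    [expR (- (c / 2) n^2) <= (c / 2 * n)^-1] for [n >= 1]. *)
Lemma poly_gauss_cvg0 (c : R) (p : {poly R}) (s : R) : 0 < c -> `|s| = 1 ->
  p.[s * n%:R] * gauss c (s * n%:R) @[n --> \oo] --> 0.
Proof.
move=> c0 s1; have [C [k [C0 Ck]]] := horner_le_expR p.
have c2 : c / 2 < c by lra.
pose E := expR (k ^+ 2 / (4 * (c - c / 2))).
apply/norm_cvg0P.
apply: (@squeeze_cvgr _ _ _ _ (cst 0) (fun n => C * E * (2 / c) * n%:R^-1)).
- near=> n; rewrite normr_ge0 /=.
  have n0 : 1 <= n%:R :> R by rewrite ler1n; near: n; exact: nbhs_infty_gt.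
  have np : 0 < n%:R :> R by exact: lt_le_trans n0.
  rewrite normrM [`|gauss _ _|]gtr0_norm ?gauss_gt0 //.
  apply: le_trans (ler_wpM2r (ltW (gauss_gt0 _ _)) (Ck _)) _.
  rewrite -(mulrA C) -2!(mulrA C); apply: ler_wpM2l => //.
  apply: le_trans (expR_mul_gauss_le _ _ _ _ c2) _; rewrite -mulrA.
  apply: ler_wpM2l; first exact: expR_ge0.
  rewrite /gauss exprMn -[s ^+ 2]real_normK ?num_real // s1 expr1n mul1r.
  have -> : 2 / c / n%:R = (c / 2 * n%:R)^-1 by field; rewrite !gt_eqF.
  rewrite expRN lef_pV2 ?posrE ?expR_gt0 ?mulr_gt0 ?divr_gt0 //.
  apply: (@le_trans _ _ (c / 2 * n%:R ^+ 2)).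
    apply: ler_wpM2l; first by rewrite divr_ge0 // ltW.
    by rewrite expr2 ler_peMl // ltW.
  by apply: le_trans (expR_ge1Dx _); rewrite lerDr.
- exact: cvg_cst.
- rewrite -[X in _ --> X](mulr0 (C * E * (2 / c))).
  apply: cvgM; first exact: cvg_cst.
  apply/gtr0_cvgV0; last exact: cvgr_idn.
  by near=> n; rewrite ltr0n; near: n; exact: nbhs_infty_gt.
Unshelve. all: by end_near.
Qed.

(** The integrand is the derivative of [p] times the Gaussian. Over [[-n, n]] it integrates to a
    difference of boundary values, which tends to 0; dominated convergence recovers the whole
    line. *)
Lemma integral_deriv_poly_gauss (c : R) (p : {poly R}) : 0 < c ->
  \int[mu]_x ((p^`() - (2 * c) *: ('X * p)).[x] * gauss c x) = 0.
Proof.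
move=> c0; set q := p^`() - _.
pose f x := (q.[x] * gauss c x)%:E.
pose F x := p.[x] * gauss c x.
have cq : continuous (fun x => q.[x] * gauss c x).
  move=> x; apply: differentiable_continuous; apply/derivable1_diffP.
  by have [] := is_derive_poly_gauss c q x.
have cF : continuous F.
  move=> x; apply: differentiable_continuous; apply/derivable1_diffP.
  by have [] := is_derive_poly_gauss c p x.
pose I n : set R := [set` `[- n%:R, n%:R]].
pose f_ n := f \_ (I n).
have mf : measurable_fun setT f by apply/measurable_EFinP; exact: continuous_measurable_fun.
have If := integrable_poly_gauss c q c0.
have [|||||_ _] := @dominated_convergence _ _ _ mu _ measurableT f_ f (abse \o f).
- move=> n; apply/(measurable_restrictT _ _).1 => //; first exact: measurable_itv.
  exact: measurable_funTS.
- exact: mf.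
- apply: aeW => x _; apply: cvg_near_cst; near=> n.
  rewrite /f_ patchE mem_set // /I /= in_itv /= -ler_norml ltW //.
  by near: n; exact: nbhs_infty_gtr.
- exact: integrable_abse.
- apply: aeW => x n _; rewrite /f_ patchE; case: ifP => _ //.
  by rewrite abse0; exact: abse_ge0.
rewrite /f_ => cvgI.
rewrite /Rintegral -/f; suff -> : (\int[mu]_x f x)%E = 0%E by [].
apply: (cvg_unique _ cvgI); first exact: ereal_hausdorff.
have E : \forall n \near \oo, (F (1 * n%:R) - F ((-1) * n%:R))%:E = (\int[mu]_x (f \_ (I n)) x)%E.
  near=> n; have n0 : (0 < n)%N by near: n; exact: nbhs_infty_gt.
  rewrite -integral_mkcond mul1r mulN1r EFinB; symmetry.
  apply: continuous_FTC2.
  - by rewrite gtrN // ltr0n.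
  - exact: continuous_subspaceT.
  - split=> [x _||]; last 2 first.
    + exact/cvg_at_right_filter/cF.
    + exact/cvg_at_left_filter/cF.
    + by have [] := is_derive_poly_gauss c p x.
  - by move=> x _; rewrite derive1E; have [_] := is_derive_poly_gauss c p x.
apply: cvg_trans (near_eq_cvg E) _.
apply/fine_cvgP; split; first by apply: nearW.
rewrite -[X in _ --> X](subr0 0); apply: cvgB; apply: poly_gauss_cvg0 => //.
  exact: normr1.
by rewrite normrN1.
Unshelve. all: by end_near.
Qed.

End GaussianIntegrationByParts.

(** * Hermite functions *)

Section Hermite.
Context {R : realType}.
Local Notation mu := (@lebesgue_measure R).

Fixpoint hermite_poly (l : nat) : {poly R} :=
  if l is n.+1 then 2 *: ('X * hermite_poly n) - (hermite_poly n)^`() else 1.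

Lemma deriv_hermite_poly l :
  (hermite_poly l.+1)^`() = (2 * l.+1%:R) *: hermite_poly l.
Proof.
elim: l => [|l ih].
  by rewrite /= mulr1 (derivC 1) subr0 derivZ derivX mulr1.
rewrite [hermite_poly l.+2]/= derivB derivZ derivM derivX mul1r.
rewrite -[2 *: ('X * _) - _]/(hermite_poly l.+1) ih derivZ.
rewrite /= -!mul_polyC !polyCM -[l.+2%:R]natr1 polyCD polyC1.
ring.
Qed.

(** Degree and leading coefficient at once, as elimination from the top degree down requires in
    [hermite_poly_span]. *)
Lemma coef_hermite_poly l k : (l <= k)%N ->
  (hermite_poly l)`_k = if k == l then 2 ^+ l else 0.
Proof.
elim: l k => [|l ih] k; first by rewrite coef1; case: k.
case: k => // k lk; rewrite /= coefB coefZ coefXM coef_deriv /= eqSS ih //.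
rewrite ih; last by rewrite ltnW // ltnW.
rewrite [k.+2 == l]gtn_eqF ?mul0rn ?subr0; last by rewrite ltnW.
by case: ifP => _; rewrite ?mulr0 // exprS.
Qed.

Lemma hermite_poly_span n (p : {poly R}) : (size p <= n)%N ->
  exists a : nat -> R, p = \sum_(l < n) a l *: hermite_poly l.
Proof.
elim: n p => [|n ih] p.
  rewrite leqn0 size_poly_eq0 => /eqP ->; exists (fun=> 0).
  by rewrite big_ord0.
move=> sp; pose b := p`_n / 2 ^+ n.
have [|a pa] := ih (p - b *: hermite_poly n).
  apply/leq_sizeP => k nk; rewrite coefB coefZ coef_hermite_poly //.
  case: eqP => [->|/eqP kn]; first by rewrite divfK ?subrr // expf_neq0.
  rewrite mulr0 subr0 nth_default //; apply: leq_trans sp _.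
  by rewrite ltn_neqAle eq_sym kn.
exists (fun l => if l == n then b else a l).
rewrite big_ord_recr /= eqxx -[LHS](subrK (b *: hermite_poly n)) pa; congr (_ + _).
by apply: eq_bigr => i _; rewrite ltn_eqF.
Qed.

(** Differentiation replaces [p] by [p' - 2 X p], the opposite of the recurrence of [hermite_poly];
    hence the sign. *)
Lemma derive1n_gauss l : derive1n l (fun s : R => expR (- s ^+ 2)) =
  (fun s => ((-1) ^+ l *: hermite_poly l).[s] * gauss 1 s).
Proof.
elim: l => [|l ih].
  by apply/funext => s; rewrite derive1n0 /= expr0 scale1r hornerC mul1r /gauss mul1r.
rewrite derive1nS ih; apply/funext => s; rewrite derive1E.
have [_ ->] := is_derive_poly_gauss 1 ((-1) ^+ l *: hermite_poly l) s.
congr (_.[_] * _); rewrite /= derivZ exprS -!mul_polyC !polyCM polyCN; ring.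
Qed.

Lemma hermiteE l (t : R) : hermite l t = (hermite_poly l).[t].
Proof.
rewrite /hermite derive1n_gauss /gauss hornerZ mul1r.
transitivity ((-1) ^+ l * (-1) ^+ l * (expR (t ^+ 2) * expR (- t ^+ 2)) *
  (hermite_poly l).[t]); first by ring.
by rewrite -exprMn mulrNN mulr1 expr1n expRN divff ?mul1r // gt_eqF // expR_gt0.
Qed.

Variables (K : R) (K0 : 0 < K).

Definition gauss_moment (q : {poly R}) : R :=
  \int[mu]_x (q.[Num.sqrt K * x] * gauss K x).

Let comp_scale (q : {poly R}) x : (q \Po (Num.sqrt K *: 'X)).[x] = q.[Num.sqrt K * x].
Proof. by rewrite horner_comp hornerZ hornerX. Qed.

Let gauss_momentE q : gauss_moment q =
  \int[mu]_x ((q \Po (Num.sqrt K *: 'X)).[x] * gauss K x).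
Proof. by apply: eq_Rintegral => x _; rewrite comp_scale. Qed.

Lemma gauss_moment_lin a (p q : {poly R}) :
  gauss_moment (a *: p + q) = a * gauss_moment p + gauss_moment q.
Proof.
rewrite !gauss_momentE -RintegralZl //; last exact: integrable_poly_gauss.
rewrite -RintegralD //; last exact: integrable_poly_gauss; last first.
  have := @integrableZl _ _ _ mu _ measurableT a _
    (integrable_poly_gauss _ (p \Po (Num.sqrt K *: 'X)) K0).
  by apply: eq_integrable => // x _; rewrite /= EFinM.
by apply: eq_Rintegral => x _; rewrite comp_polyD comp_polyZ hornerD hornerZ; ring.
Qed.

Lemma gauss_moment0 : gauss_moment 0 = 0.
Proof.
have := gauss_moment_lin (-1) 0 0; rewrite scaler0 addr0 mulN1r addNr.
exact.
Qed.

Lemma gauss_momentZ a (p : {poly R}) : gauss_moment (a *: p) = a * gauss_moment p.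
Proof. by rewrite -[X in gauss_moment X]addr0 gauss_moment_lin gauss_moment0 addr0. Qed.

(** Integration by parts for [q (sqrt K x)]: the chain rule and [K = sqrt K * sqrt K] leave a common
    nonzero factor [sqrt K]. *)
Lemma gauss_moment_deriv (q : {poly R}) :
  gauss_moment (2 *: ('X * q)) = gauss_moment q^`().
Proof.
have := integral_deriv_poly_gauss K (q \Po (Num.sqrt K *: 'X)) K0.
rewrite (_ : _ - _ = (Num.sqrt K *: ((-1) *: (2 *: ('X * q)) + q^`())) \Po (Num.sqrt K *: 'X)).
  rewrite -gauss_momentE (gauss_momentZ (Num.sqrt K)) => /eqP.
  rewrite mulf_eq0 sqrtr_eq0 leNgt K0 /= gauss_moment_lin mulN1r addrC subr_eq0.
  by move=> /eqP.
have KE : (Num.sqrt K)%:P * (Num.sqrt K)%:P = K%:P :> {poly R}.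
  by rewrite -polyCM -expr2 sqr_sqrtr // ltW.
rewrite deriv_comp derivZ derivX comp_polyZ comp_polyD !comp_polyZ comp_polyM comp_polyX.
rewrite -!mul_polyC !polyCM -KE polyCN; ring.
Qed.

(** By the recurrence the product is [- (H_l q)' + 2 X H_l q + H_l q'], and the moments of the first
    two terms cancel. *)
Lemma gauss_moment_hermite l (q : {poly R}) :
  gauss_moment (hermite_poly l.+1 * q) = gauss_moment (hermite_poly l * q^`()).
Proof.
have -> : hermite_poly l.+1 * q = (-1) *: (hermite_poly l * q)^`() +
    (2 *: ('X * (hermite_poly l * q)) + hermite_poly l * q^`()).
  by rewrite /= derivM -!mul_polyC polyCN; ring.
rewrite gauss_moment_lin -[2 *: _]scale1r gauss_moment_lin gauss_moment_deriv.
by rewrite mul1r mulN1r addKr.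
Qed.

(** Both indices drop by 1 at the cost of a factor [2 (j + 1)]. If they differ, one factor reaches
    [H_0 = 1] first, and differentiating it gives 0. *)
Lemma hermite_orthogonal i j : gauss_moment (hermite_poly i * hermite_poly j) =
  (i == j)%:R * (2 ^+ i * i`!%:R * Num.sqrt (pi / K)).
Proof.
have m1 : gauss_moment 1 = Num.sqrt (pi / K).
  by rewrite -integral_gauss //; apply: eq_Rintegral => x _; rewrite hornerC mul1r.
elim: i j => [|i ih] [|j].
- by rewrite mulr1 m1 eqxx expr0 fact0 !mul1r.
- by rewrite mulrC gauss_moment_hermite (derivC 1) mulr0 gauss_moment0 mul0r.
- by rewrite gauss_moment_hermite (derivC 1) mulr0 gauss_moment0 mul0r.
rewrite gauss_moment_hermite deriv_hermite_poly -scalerAr.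
rewrite gauss_momentZ ih eqSS; case: eqP => [<-|_]; last by rewrite !mul0r mulr0.
by rewrite factS natrM exprS; ring.
Qed.

(** The square of the first factor is the inverse of [2^l l! sqrt (pi / K)], the moment of the
    square of [hermite_poly l]. *)
Definition hermite_fun (l : nat) (x : R) : R :=
  Num.sqrt (Num.sqrt (K / pi) * (2 ^+ l * l`!%:R)^-1) * gauss (K / 2) x *
  (hermite_poly l).[Num.sqrt K * x].

Let K2 : 0 < K / 2. Proof. by rewrite divr_gt0. Qed.

Lemma hermite_fun_sqint l : sqint mu (hermite_fun l).
Proof.
have := sqintZ mu (Num.sqrt (Num.sqrt (K / pi) * (2 ^+ l * l`!%:R)^-1)) _
  (sqint_horner_gauss _ (hermite_poly l \Po (Num.sqrt K *: 'X)) K2).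
rewrite (_ : (fun x => _) = hermite_fun l) //.
by apply/funext => x; rewrite comp_scale /hermite_fun; ring.
Qed.

Lemma hermite_fun_orthonormal i j :
  dot mu (hermite_fun i) (hermite_fun j) = (i == j)%:R.
Proof.
pose N l : R := Num.sqrt (Num.sqrt (K / pi) * (2 ^+ l * l`!%:R)^-1).
transitivity (N i * N j * gauss_moment (hermite_poly i * hermite_poly j)).
  rewrite gauss_momentE -RintegralZl //; last exact: integrable_poly_gauss.
  apply: eq_Rintegral => x _; rewrite comp_scale hornerM /hermite_fun.
  have -> : gauss K x = gauss (K / 2) x * gauss (K / 2) x.
    by rewrite -expRD; congr expR; field.
  by rewrite /N; ring.
rewrite hermite_orthogonal; have [<-|_] := eqVneq i j; last by rewrite mul0r mulr0.
have P : 0 < 2 ^+ i * i`!%:R :> R by rewrite mulr_gt0 ?exprn_gt0 // ltr0n fact_gt0.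
rewrite -expr2 sqr_sqrtr; last by rewrite mulr_ge0 ?sqrtr_ge0 // invr_ge0 ltW.
rewrite mul1r mulrA divfK ?gt_eqF // -sqrtrM; last by rewrite divr_ge0 ?pi_ge0 // ltW.
rewrite (_ : K / pi * (pi / K) = 1) ?sqrtr1 //.
by rewrite mulrA divfK ?divff ?gt_eqF ?pi_gt0.
Qed.

(** Density is applied at the rate [K / 2] of a single Hermite function. The polynomial found is
    rewritten in the variable [sqrt K x] and expanded in Hermite polynomials. *)
Lemma hermite_fun_dense (f : R -> R) : sqint mu f -> forall e : R, 0 < e ->
  exists n a, dot mu (residual hermite_fun f a n) (residual hermite_fun f a n) <= e.
Proof.
move=> sf e e0.
have [_ /(_ e e0)[_ [p ->] pe]] := poly_gauss_dense _ K2 f sf.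
have sK : Num.sqrt K != 0 by rewrite sqrtr_eq0 -ltNge.
pose q := p \Po ((Num.sqrt K)^-1 *: 'X).
have pq x : p.[x] = q.[Num.sqrt K * x].
  by rewrite horner_comp hornerZ hornerX mulKf.
have [a qa] := hermite_poly_span _ q (leqnn _).
pose N l : R := Num.sqrt (Num.sqrt (K / pi) * (2 ^+ l * l`!%:R)^-1).
have N0 l : N l != 0.
  rewrite sqrtr_eq0 -ltNge; apply: mulr_gt0.
    by rewrite sqrtr_gt0 divr_gt0 ?pi_gt0.
  by rewrite invr_gt0 mulr_gt0 ?exprn_gt0 // ltr0n fact_gt0.
exists (size q), (fun l => a l / N l).
have E x : residual hermite_fun f (fun l => a l / N l) (size q) x =
    f x - p.[x] * gauss (K / 2) x.
  rewrite /residual pq (congr1 (fun r => r.[Num.sqrt K * x]) qa).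
  rewrite horner_sum mulr_suml; congr (_ - _).
  by apply: eq_bigr => i _; rewrite hornerZ /hermite_fun -/(N i); field.
by rewrite (eq_dot mu _ _ _ _ E E).
Qed.

End Hermite.

(** * Bicomplex expansions *)

Section HermiteExpansion.
Context {R : realType}.
Local Notation mu := (@lebesgue_measure R).

Lemma hermite_expansion (K : R) (f : R -> R) : 0 < K -> sqint mu f ->
  exists a, dot mu (residual (hermite_fun K) f a n) (residual (hermite_fun K) f a n)
    @[n --> \oo] --> 0.
Proof.
move=> K0 sf; exists (fun l => dot mu f (hermite_fun K l)).
apply: residual_cvg0 => //.
- by move=> l; exact: hermite_fun_sqint.
- by move=> i j; exact: hermite_fun_orthonormal.
- exact: hermite_fun_dense.
Qed.

Lemma phi_hatE (m omega hbar xi : R) l x :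
  0 < m -> 0 < omega -> 0 < hbar -> 0 < xi ->
  phi_hat m omega hbar xi l x = hermite_fun (m * omega / (hbar * xi)) l x.
Proof.
move=> m0 o0 h0 x0; rewrite /phi_hat /hermite_fun hermiteE /theta.
have -> : m * omega / (pi * hbar * xi) = m * omega / (hbar * xi) / pi.
  by move: (pi : R) => P; rewrite !invfM; ring.
set K := _ / (hbar * xi); have K0 : 0 <= K by rewrite divr_ge0 ?mulr_ge0 ?ltW.
by congr (_ * expR _ * _); rewrite exprMn sqr_sqrtr // mulNr mulrAC.
Qed.

Lemma L2norm_sqr (f : R -> R[i]) :
  measurable_fun setT (fun x => complex.Re (f x)) ->
  measurable_fun setT (fun x => complex.Im (f x)) ->
  (L2norm f ^+ 2 =
   \int[mu]_x (complex.Re (f x) ^+ 2 + complex.Im (f x) ^+ 2)%:E)%E.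
Proof.
move=> mr mi; rewrite /L2norm unlock.
rewrite poweR12_sqrt; last first.
  by apply: integral_ge0 => x _; exact: poweR_ge0.
rewrite sqr_sqrte; last by apply: integral_ge0 => x _; exact: poweR_ge0.
apply: eq_integral => x _ /=; case: (f x) => a b /=.
rewrite ger0_norm ?sqrtr_ge0 // powR_mulrn ?sqrtr_ge0 //.
by rewrite sqr_sqrtr // addr_ge0 ?sqr_ge0.
Qed.

Lemma L2_sqint (f : R -> R[i]) : L2 f ->
  sqint mu (fun x => complex.Re (f x)) /\ sqint mu (fun x => complex.Im (f x)).
Proof.
move=> [mr mi nf].
have I : mu.-integrable setT
    (fun x => (complex.Re (f x) ^+ 2 + complex.Im (f x) ^+ 2)%:E).
  apply/integrableP; split.
    by apply/measurable_EFinP; apply: measurable_funD; exact: measurable_funX.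
  under eq_integral do rewrite /= ger0_norm ?addr_ge0 ?sqr_ge0 //.
  rewrite -L2norm_sqr // expe2 lte_mul_pinfty ?Lnorm_ge0 //.
  by rewrite ge0_fin_numE ?Lnorm_ge0.
split; split=> //; apply: le_integrable I => //;
  do ?[by apply/measurable_EFinP; exact: measurable_funX];
  move=> x _; rewrite /= lee_fin !ger0_norm ?addr_ge0 ?sqr_ge0 //.
  by rewrite lerDl sqr_ge0.
by rewrite lerDr sqr_ge0.
Qed.

Lemma L2norm_sqr_dot (f : R -> R[i]) (a b : R -> R) :
  sqint mu a -> sqint mu b -> (forall x, f x = Complex (a x) (b x)) ->
  (L2norm f ^+ 2 = (dot mu a a + dot mu b b)%:E)%E.
Proof.
move=> sa sb /funext ->; rewrite L2norm_sqr /=; [|exact: sa.1|exact: sb.1].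
rewrite EFinD -!integral_sqr // -integralD //; [exact: sa.2|exact: sb.2].
Qed.

Section Components.
Variables (hat : bicomplex R -> R[i]) (h : nat -> R -> R).
Variables (phi : nat -> R -> bicomplex R) (u : R -> bicomplex R) (w : nat -> bicomplex R).
Hypothesis hat_lin : forall w u v, hat (w * u + v) = hat w * hat u + hat v.
Hypothesis hat_phi : forall l x, hat (phi l x) = (h l x)%:C%C.

(** [hat] stands for either idempotent component. Those of [phi] are real, so [hat (w l)] acts on
    real and imaginary parts separately. *)
Lemma hat_residual n x : hat (u x - \sum_(l < n) w l * phi l x) =
  Complex (residual h (fun x => complex.Re (hat (u x))) (fun l => complex.Re (hat (w l))) n x)
          (residual h (fun x => complex.Im (hat (u x))) (fun l => complex.Im (hat (w l))) n x).
Proof.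
rewrite /residual; elim: n => [|n ih].
  by rewrite !big_ord0 !subr0; case: (hat (u x)).
(* Adding the last term to both sides produces the form [w * u + v] of [hat_lin] and leaves the
   residual of length [n]. *)
apply: (addrI (hat (w n) * hat (phi n x))); rewrite -hat_lin !big_ord_recr /=.
have -> : w n * phi n x + (u x - (\sum_(i < n) w i * phi i x + w n * phi n x)) =
  u x - \sum_(i < n) w i * phi i x by ring.
rewrite ih hat_phi; case: (hat (w n)) => a b.
by simpc; rewrite /=; congr Complex; ring.
Qed.

End Components.

(** Applied to the four squared real residuals, for which the expression is [bcL2_norm]; by
    nonnegativity their sum squeezes each of them. *)
Lemma cvg0_sum4 (a b c d : nat -> R) :
  (forall n, 0 <= a n) -> (forall n, 0 <= b n) ->
  (forall n, 0 <= c n) -> (forall n, 0 <= d n) ->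
  ((Num.sqrt 2)^-1 * Num.sqrt (a n + b n + (c n + d n)))%:E @[n --> \oo] --> 0%E <->
  [/\ a n @[n --> \oo] --> 0, b n @[n --> \oo] --> 0,
      c n @[n --> \oo] --> 0 & d n @[n --> \oo] --> 0].
Proof.
move=> a0 b0 c0 d0; have s2 : Num.sqrt 2 != 0 :> R by rewrite sqrtr_eq0 -ltNge.
split=> [/fine_cvgP[_ lim]|[la lb lc ld]].
  have lS : a n + b n + (c n + d n) @[n --> \oo] --> 0.
    have lim2 := @cvgM _ _ _ eventually_filter (fun=> Num.sqrt 2) _ _ _
      (@cvg_cst _ _ _ _ eventually_filter) lim.
    have := @cvgM _ _ _ eventually_filter _ _ _ _ lim2 lim2; rewrite !mulr0.
    apply: cvg_trans; apply: near_eq_cvg; apply: nearW => n /=.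
    by rewrite mulVKf // -expr2 sqr_sqrtr // !addr_ge0.
  have sq (e : nat -> R) : (forall n, 0 <= e n) ->
      (forall n, e n <= a n + b n + (c n + d n)) -> e n @[n --> \oo] --> 0.
    move=> e0 le; apply: (@squeeze_cvgr _ _ _ _ (cst 0) (fun n => a n + b n + (c n + d n))) => //.
      by apply: nearW => n; rewrite e0 le.
    exact: cvg_cst.
  by split; apply: sq => // n; have := a0 n; have := b0 n; have := c0 n; have := d0 n; lra.
apply/fine_cvgP; split; first by apply: nearW.
rewrite /= -[X in _ --> X](mulr0 (Num.sqrt 2)^-1); apply: cvgM; first exact: cvg_cst.
rewrite -[X in _ --> X]sqrtr0; apply: (@continuous_cvg _ _ _ _ _ _ (@Num.sqrt R)).
  exact: sqrt_continuous.
rewrite (_ : 0 = 0 + 0 + (0 + 0)); last by rewrite !addr0.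
by apply: cvgD; apply: cvgD.
Qed.

End HermiteExpansion.

Theorem theorem4p2 (R : realType) (m omega hbar : R) (xi : bicomplex R)
    (hm : 0 < m) (homega : 0 < omega) (hhbar : 0 < hbar)
    (hxi1 : 0 < bc_hat1 xi) (hxi2 : 0 < bc_hat2 xi)
    (u : R -> bicomplex R) (hu : bcL2 u) :
  exists! w : nat -> bicomplex R, bcL2_expansion (phi m omega hbar xi) u w.
Proof.
pose K1 := m * omega / (hbar * complex.Re (bc_hat1 xi)).
pose K2 := m * omega / (hbar * complex.Re (bc_hat2 xi)).
have x1 : 0 < complex.Re (bc_hat1 xi) by move: hxi1; rewrite ltcE => /andP[].
have x2 : 0 < complex.Re (bc_hat2 xi) by move: hxi2; rewrite ltcE => /andP[].
have K10 : 0 < K1 by rewrite divr_gt0 // mulr_gt0.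
have K20 : 0 < K2 by rewrite divr_gt0 // mulr_gt0.
have [/L2_sqint[s1r s1i] /L2_sqint[s2r s2i]] := hu.
have phi1 l x : bc_hat1 (phi m omega hbar xi l x) = (hermite_fun K1 l x)%:C%C.
  by rewrite /phi bc_hat1_idem phi_hatE.
have phi2 l x : bc_hat2 (phi m omega hbar xi l x) = (hermite_fun K2 l x)%:C%C.
  by rewrite /phi bc_hat2_idem phi_hatE.
pose conv K f a := dot (@lebesgue_measure R) (residual (hermite_fun K) f a n)
    (residual (hermite_fun K) f a n) @[n --> \oo] --> 0.
have sres K f a n : 0 < K -> sqint (@lebesgue_measure R) f ->
    sqint (@lebesgue_measure R) (residual (hermite_fun K) f a n).
  by move=> K0 sf; apply: sqintB => //; apply: sqint_sum => l; exact: hermite_fun_sqint.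
(* A bicomplex expansion amounts to four independent real ones. *)
have E w : bcL2_expansion (phi m omega hbar xi) u w <->
  [/\ conv K1 (fun x => complex.Re (bc_hat1 (u x))) (fun l => complex.Re (bc_hat1 (w l))),
      conv K1 (fun x => complex.Im (bc_hat1 (u x))) (fun l => complex.Im (bc_hat1 (w l))),
      conv K2 (fun x => complex.Re (bc_hat2 (u x))) (fun l => complex.Re (bc_hat2 (w l))) &
      conv K2 (fun x => complex.Im (bc_hat2 (u x))) (fun l => complex.Im (bc_hat2 (w l)))].
  rewrite /conv -cvg0_sum4; [|by move=> n; exact: dot_ge0..].
  have r1 := hat_residual _ _ _ u w (@bc_hat1_lin R) phi1.
  have r2 := hat_residual _ _ _ u w (@bc_hat2_lin R) phi2.
  rewrite /bcL2_expansion; split; apply: cvg_trans; apply: near_eq_cvg;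
    apply: nearW => n; rewrite /bcL2_norm;
    rewrite (L2norm_sqr_dot _ _ _ _ _ (r1 n)) ?(L2norm_sqr_dot _ _ _ _ _ (r2 n)) //;
    exact: sres.
have [a1 la1] := hermite_expansion _ _ K10 s1r.
have [b1 lb1] := hermite_expansion _ _ K10 s1i.
have [a2 la2] := hermite_expansion _ _ K20 s2r.
have [b2 lb2] := hermite_expansion _ _ K20 s2i.
pose w0 l := bc_e1 R * bcC (Complex (a1 l) (b1 l)) + bc_e2 R * bcC (Complex (a2 l) (b2 l)).
have w01 l : bc_hat1 (w0 l) = Complex (a1 l) (b1 l) by exact: bc_hat1_idem.
have w02 l : bc_hat2 (w0 l) = Complex (a2 l) (b2 l) by exact: bc_hat2_idem.
have uniq K f a a' : 0 < K -> sqint (@lebesgue_measure R) f ->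
    conv K f a -> conv K f a' -> a =1 a'.
  move=> K0 sf; apply: expansion_unique => //.
  - by move=> l; exact: hermite_fun_sqint.
  - by move=> i j; exact: hermite_fun_orthonormal.
exists w0; split.
  by apply/E; split; [move: la1|move: lb1|move: la2|move: lb2]; congr (conv _ _ _);
    apply/funext => l; rewrite ?w01 ?w02.
(* Real uniqueness fixes both components of [w l], from which [bc_hatE] rebuilds it. *)
move=> w /E[l1 l2 l3 l4]; apply/funext => l; rewrite [RHS]bc_hatE /w0.
rewrite (uniq _ _ _ _ K10 s1r la1 l1 l) (uniq _ _ _ _ K10 s1i lb1 l2 l).
rewrite (uniq _ _ _ _ K20 s2r la2 l3 l) (uniq _ _ _ _ K20 s2i lb2 l4 l).
by case: (bc_hat1 (w l)) (bc_hat2 (w l)) => [? ?] [? ?].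
Qed.
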